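(* Let $U:(0,\infty)\to\mathbb R$ be a $C^2$ function, and consider the system $\dot x=v$, $\dot v=-U'(|x|)x/|x|$ on $\mathbb R^3_0\times\mathbb R^3$ with $E(x,v)=\tfrac12|v|^2+U(|x|)$ and $L(x,v)=x\times v$. Take $(x_0,v_0)\in\mathbb R^3_0\times\mathbb R^3$ with $x_0\times v_0\ne0$, set $E_0=E(x_0,v_0)$, $L_0=L(x_0,v_0)$, and with $k_1,k_2>0$ let $V(x,v)=\tfrac{k_1}{2}|E(x,v)-E_0|^2+\tfrac{k_2}{2}|L(x,v)-L_0|^2$. Suppose $V^{-1}(0)$ is compact and there is no $r>0$ satisfying simultaneously $$E_0=\tfrac12 rU'(r)+U(r)\quad\text{and}\quad |L_0|^2=r^3U'(r).$$ Then (after restricting, if necessary, to an open neighborhood of $V^{-1}(0)$) there is $c>0$ such that $V^{-1}([0,c])$ is compact and its only critical points of $V$ are those in $V^{-1}(0)$, and every trajectory of $$\dot x = v - k_1\Delta E\,U'(|x|)\tfrac{x}{|x|} - k_2 v\times\Delta L,\qquad \dot v = -U'(|x|)\tfrac{x}{|x|} - k_1\Delta E\, v - k_2\Delta L\times x,$$ with $\Delta E=E(x,v)-E_0$, $\Delta L=L(x,v)-L_0$, starting in $V^{-1}([0,c])$ remains in $V^{-1}([0,c])$ for all $t\ge0$ and converges to $V^{-1}(0)=\{(x,v):E(x,v)=E_0,\ L(x,v)=L_0\}$ as $t\to\infty$.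
   Context: $\mathbb R^3_0=\mathbb R^3\setminus\{0\}$. *)

(* Defs.v *)
From Stdlib Require Import Reals List.
Open Scope R_scope.

Record vec3 : Type := mkv { c1 : R; c2 : R; c3 : R }.

Definition vadd (a b : vec3) : vec3 := mkv (c1 a + c1 b) (c2 a + c2 b) (c3 a + c3 b).
Definition vscale (s : R) (a : vec3) : vec3 := mkv (s * c1 a) (s * c2 a) (s * c3 a).
Definition vopp (a : vec3) : vec3 := vscale (-1) a.
Definition vsub (a b : vec3) : vec3 := vadd a (vopp b).
Definition vzero : vec3 := mkv 0 0 0.
Definition vdot (a b : vec3) : R := c1 a * c1 b + c2 a * c2 b + c3 a * c3 b.
Definition vnorm (a : vec3) : R := sqrt (vdot a a).
Definition vcross (a b : vec3) : vec3 :=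
  mkv (c2 a * c3 b - c3 a * c2 b)
      (c3 a * c1 b - c1 a * c3 b)
      (c1 a * c2 b - c2 a * c1 b).

Definition state : Type := (vec3 * vec3)%type.
Definition in_domain (p : state) : Prop := fst p <> vzero.

Definition sadd (p q : state) : state := (vadd (fst p) (fst q), vadd (snd p) (snd q)).
Definition sscale (s : R) (p : state) : state := (vscale s (fst p), vscale s (snd p)).
Definition sdist (p q : state) : R :=
  sqrt (vdot (vsub (fst p) (fst q)) (vsub (fst p) (fst q))
        + vdot (vsub (snd p) (snd q)) (vsub (snd p) (snd q))).

Definition sopen (S : state -> Prop) : Prop :=
  forall p, S p -> exists eps, 0 < eps /\ forall q, sdist p q < eps -> S q.

Definition scompact (K : state -> Prop) : Prop :=
  forall (I : Type) (O : I -> state -> Prop),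
    (forall i, sopen (O i)) ->
    (forall p, K p -> exists i, O i p) ->
    exists l : list I, forall p, K p -> exists i, In i l /\ O i p.

Definition Energy (U : R -> R) (p : state) : R :=
  / 2 * vdot (snd p) (snd p) + U (vnorm (fst p)).
Definition AngMom (p : state) : vec3 := vcross (fst p) (snd p).

Definition Vfun (U : R -> R) (k1 k2 E0 : R) (L0 : vec3) (p : state) : R :=
  k1 / 2 * (Energy U p - E0) ^ 2
  + k2 / 2 * vdot (vsub (AngMom p) L0) (vsub (AngMom p) L0).

Definition critical_point (f : state -> R) (p : state) : Prop :=
  forall h : state, derivable_pt_lim (fun t => f (sadd p (sscale t h))) 0 0.

(* Controlled vector field; U1 stands for U'. *)
Definition controlled_field (U U1 : R -> R) (k1 k2 E0 : R) (L0 : vec3)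
  (p : state) : state :=
  let x := fst p in let v := snd p in
  let dE := Energy U p - E0 in
  let dL := vsub (AngMom p) L0 in
  let n := vscale (/ vnorm x) x in
  (vsub (vsub v (vscale (k1 * dE * U1 (vnorm x)) n)) (vscale k2 (vcross v dL)),
   vsub (vsub (vopp (vscale (U1 (vnorm x)) n)) (vscale (k1 * dE) v))
        (vscale k2 (vcross dL x))).

Definition has_sderiv (g : R -> state) (t : R) (d : state) : Prop :=
  derivable_pt_lim (fun s => c1 (fst (g s))) t (c1 (fst d)) /\
  derivable_pt_lim (fun s => c2 (fst (g s))) t (c2 (fst d)) /\
  derivable_pt_lim (fun s => c3 (fst (g s))) t (c3 (fst d)) /\
  derivable_pt_lim (fun s => c1 (snd (g s))) t (c1 (snd d)) /\
  derivable_pt_lim (fun s => c2 (snd (g s))) t (c2 (snd d)) /\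
  derivable_pt_lim (fun s => c3 (snd (g s))) t (c3 (snd d)).

Definition forward_solution (F : state -> state) (g : R -> state) : Prop :=
  forall t, 0 <= t -> in_domain (g t) /\ has_sderiv g t (F (g t)).

Definition converges_to_set (g : R -> state) (S : state -> Prop) : Prop :=
  forall eps, 0 < eps -> exists T, forall t, T <= t ->
    exists q, S q /\ sdist (g t) q < eps.

(* Main.v *)
(** The controlled field is the Hamiltonian field minus the gradient of [V], and
    the Hamiltonian field is tangent to the level sets of [V], so
    [dV/dt = - |grad V|^2] along trajectories.  Where the energy and angular
    momentum have independent gradients, [grad V = 0] forces [V = 0]; for nonzero
    angular momentum the gradients are dependent only at states of circular
    orbits, which the hypothesis excludes on the zero set [Z] of [V].  Hence
    [V = 0] is the only critical value on some open set containing [Z], and by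
    compactness there is a continuous [psi], negative on [Z], with [psi <= 0]
    compact inside that set.  Taking [c] below the minimum of [V] on [psi = 0],
    no trajectory starting in [psi < 0], [V <= c] can leave.  On the compact part
    of this region where [V >= eps], [|grad V|^2] is bounded below by a positive
    constant, so [V] drops below every [eps], and therefore the distance to [Z]
    tends to [0].  Global existence follows by Picard iteration for a bounded
    Lipschitz field that agrees with the controlled one on the region. *)

From Stdlib Require Import Reals List Lra Psatz Classical ClassicalEpsilon.
From Coquelicot Require Import Coquelicot.
Require Import Defs.
Open Scope R_scope.
Set Bullet Behavior "Strict Subproofs".

(** * Coordinates and squared distance on the state space *)

Definition coord (i : nat) (p : state) : R :=
  match i with
  | 0%nat => c1 (fst p) | 1%nat => c2 (fst p) | 2%nat => c3 (fst p)
  | 3%nat => c1 (snd p) | 4%nat => c2 (snd p) | _ => c3 (snd p)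
  end.

Definition of_coords (y : nat -> R) : state :=
  (mkv (y 0%nat) (y 1%nat) (y 2%nat), mkv (y 3%nat) (y 4%nat) (y 5%nat)).

Lemma of_coordsK (p : state) : of_coords (fun i => coord i p) = p.
Proof. destruct p as [[x1 x2 x3] [v1 v2 v3]]; reflexivity. Qed.

(** Every index above 5 repeats the last coordinate, so six premises settle all of [nat]. *)
Lemma forall_coord (P : R -> R -> Prop) (p q : state) :
  P (c1 (fst p)) (c1 (fst q)) -> P (c2 (fst p)) (c2 (fst q)) ->
  P (c3 (fst p)) (c3 (fst q)) -> P (c1 (snd p)) (c1 (snd q)) ->
  P (c2 (snd p)) (c2 (snd q)) -> P (c3 (snd p)) (c3 (snd q)) ->
  forall i, P (coord i p) (coord i q).
Proof. intros ? ? ? ? ? ? [|[|[|[|[|i]]]]]; simpl; assumption. Qed.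

Lemma of_coords_close (y z : nat -> R) (d : R) :
  (forall j, Rabs (y j - z j) <= d) ->
  forall i, Rabs (coord i (of_coords y) - coord i (of_coords z)) <= d.
Proof.
  intros H; apply (forall_coord (fun a b => Rabs (a - b) <= d)); apply H.
Qed.

(** The square keeps distances polynomial in the coordinates, so their continuity and comparisons
    avoid the square root. *)
Definition sqdist (p q : state) : R :=
  vdot (vsub (fst p) (fst q)) (vsub (fst p) (fst q))
  + vdot (vsub (snd p) (snd q)) (vsub (snd p) (snd q)).

Lemma sqdist_coord (p q : state) :
  sqdist p q =
  (coord 0 p - coord 0 q) ^ 2 + (coord 1 p - coord 1 q) ^ 2
  + (coord 2 p - coord 2 q) ^ 2 + (coord 3 p - coord 3 q) ^ 2
  + (coord 4 p - coord 4 q) ^ 2 + (coord 5 p - coord 5 q) ^ 2.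
Proof. unfold sqdist, vdot, vsub, vadd, vopp, vscale; simpl; ring. Qed.

Lemma sqdist_ge0 (p q : state) : 0 <= sqdist p q.
Proof.
  rewrite sqdist_coord.
  repeat apply Rplus_le_le_0_compat; apply pow2_ge_0.
Qed.

Lemma sdist_lt (p q : state) (e : R) :
  0 < e -> (sdist p q < e <-> sqdist p q < e ^ 2).
Proof.
  intros He; change (sdist p q) with (sqrt (sqdist p q)).
  pose proof (sqdist_ge0 p q) as Hs.
  rewrite <- (sqrt_pow2 e) at 1 by lra.
  split; intros H.
  - apply sqrt_lt_0_alt in H; exact H.
  - apply sqrt_lt_1_alt; lra.
Qed.

Lemma sqdist_refl (p : state) : sqdist p p = 0.
Proof. rewrite sqdist_coord; ring. Qed.

Lemma sdist_refl (p : state) : sdist p p = 0.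
Proof.
  change (sdist p p) with (sqrt (sqdist p p)).
  rewrite sqdist_refl; apply sqrt_0.
Qed.

Lemma sqdist_sym (p q : state) : sqdist p q = sqdist q p.
Proof. rewrite !sqdist_coord; ring. Qed.

Lemma coord_le_sdist (i : nat) (p q : state) :
  Rabs (coord i p - coord i q) <= sdist p q.
Proof.
  change (sdist p q) with (sqrt (sqdist p q)).
  rewrite <- sqrt_Rsqr_abs; apply sqrt_le_1_alt.
  rewrite sqdist_coord; unfold Rsqr.
  assert (H : forall j, 0 <= (coord j p - coord j q) ^ 2) by (intros; apply pow2_ge_0).
  pose proof (H 0%nat); pose proof (H 1%nat); pose proof (H 2%nat);
  pose proof (H 3%nat); pose proof (H 4%nat); pose proof (H 5%nat).
  destruct i as [|[|[|[|[|i]]]]]; try lra.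
  change (coord (S (S (S (S (S i))))) p) with (coord 5 p).
  change (coord (S (S (S (S (S i))))) q) with (coord 5 q); lra.
Qed.

(** * Continuity on the state space *)

(** The neighbourhood filter of [p] for [sdist]; in filter form, the limit calculus of Coquelicot
    applies directly to functions on [state]. *)
Definition snbhd (p : state) (P : state -> Prop) : Prop :=
  exists eps, 0 < eps /\ forall q, sdist p q < eps -> P q.

Global Instance snbhd_filter (p : state) : Filter (snbhd p).
Proof.
  constructor.
  - exists 1; split; [lra | trivial].
  - intros P Q [e [He HP]] [f [Hf HQ]].
    exists (Rmin e f); split; [now apply Rmin_pos|].
    intros q Hq; split; [apply HP | apply HQ];
      eapply Rlt_le_trans; eauto using Rmin_l, Rmin_r.
  - intros P Q H [e [He HP]]; exists e; split; auto.
Qed.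

Definition scont (f : state -> R) (p : state) : Prop :=
  filterlim f (snbhd p) (locally (f p)).

Lemma scont_const (a : R) (p : state) : scont (fun _ => a) p.
Proof. apply filterlim_const. Qed.

Lemma scont_coord (i : nat) (p : state) : scont (coord i) p.
Proof.
  apply filterlim_locally; intros eps.
  exists eps; split; [apply cond_pos|]; intros q Hq.
  change (Rabs (coord i q - coord i p) < eps).
  rewrite Rabs_minus_sym; eapply Rle_lt_trans; [apply coord_le_sdist | exact Hq].
Qed.

Lemma scont_plus (f g : state -> R) (p : state) :
  scont f p -> scont g p -> scont (fun q => f q + g q) p.
Proof.
  intros Hf Hg; eapply filterlim_comp_2;
    [exact Hf | exact Hg | exact (filterlim_plus (f p) (g p))].
Qed.

Lemma scont_mult (f g : state -> R) (p : state) :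
  scont f p -> scont g p -> scont (fun q => f q * g q) p.
Proof.
  intros Hf Hg; eapply filterlim_comp_2;
    [exact Hf | exact Hg | exact (filterlim_mult (f p) (g p))].
Qed.

Lemma scont_opp (f : state -> R) (p : state) :
  scont f p -> scont (fun q => - f q) p.
Proof.
  intros Hf; eapply filterlim_comp;
    [exact Hf | exact (filterlim_opp (f p))].
Qed.

Lemma scont_minus (f g : state -> R) (p : state) :
  scont f p -> scont g p -> scont (fun q => f q - g q) p.
Proof. intros Hf Hg; apply scont_plus; [exact Hf | now apply scont_opp]. Qed.

Lemma scont_pow (f : state -> R) (n : nat) (p : state) :
  scont f p -> scont (fun q => f q ^ n) p.
Proof.
  intros Hf; induction n as [|n IH]; simpl.
  - apply scont_const.
  - now apply scont_mult.
Qed.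

Lemma scont_comp (h : R -> R) (f : state -> R) (p : state) :
  scont f p -> continuity_pt h (f p) -> scont (fun q => h (f q)) p.
Proof.
  intros Hf Hh; eapply filterlim_comp;
    [exact Hf | apply continuity_pt_filterlim; exact Hh].
Qed.

Lemma scont_min (f g : state -> R) (p : state) :
  scont f p -> scont g p -> scont (fun q => Rmin (f q) (g q)) p.
Proof.
  intros Hf Hg.
  assert (E : forall a b, Rmin a b = / 2 * (a + b - Rabs (a - b))).
  { intros a b; unfold Rmin, Rabs.
    destruct (Rle_dec a b); destruct (Rcase_abs (a - b)); lra. }
  unfold scont; rewrite E.
  apply (filterlim_ext (fun q => / 2 * (f q + g q - Rabs (f q - g q)))).
  { intros q; now rewrite E. }
  apply scont_mult; [apply scont_const|].
  apply scont_minus; [now apply scont_plus|].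
  apply (scont_comp Rabs); [now apply scont_minus | apply Rcontinuity_abs].
Qed.

Lemma scont_sqdist (q p : state) : scont (fun p => sqdist p q) p.
Proof.
  unfold scont; rewrite sqdist_coord.
  eapply filterlim_ext; [intros r; symmetry; apply sqdist_coord|].
  repeat apply scont_plus; apply (scont_pow (fun _ => _)); apply scont_minus;
    try apply scont_const; apply scont_coord.
Qed.

Lemma scont_lt (f : state -> R) (a : R) (p : state) :
  scont f p -> f p < a -> snbhd p (fun q => f q < a).
Proof. intros Hf H; exact (Hf (fun y => y < a) (open_lt a (f p) H)). Qed.

Lemma scont_gt (f : state -> R) (a : R) (p : state) :
  scont f p -> a < f p -> snbhd p (fun q => a < f q).
Proof. intros Hf H; exact (Hf (fun y => a < y) (open_gt a (f p) H)). Qed.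

Definition cont_curve (g : R -> state) (t : R) : Prop :=
  forall i, continuous (fun s => coord i (g s)) t.

(** Six squares below [(e / 3) ^ 2] add up to less than [2 / 3 * e ^ 2], so a third of [e] per
    coordinate is enough. *)
Lemma sdist_lt_coords (p q : state) (e : R) :
  0 < e -> (forall i, (i <= 5)%nat -> Rabs (coord i q - coord i p) < e / 3) ->
  sdist p q < e.
Proof.
  intros He H; apply sdist_lt; [exact He|].
  rewrite sqdist_sym, sqdist_coord.
  assert (S : forall i, (i <= 5)%nat -> (coord i q - coord i p) ^ 2 < (e / 3) ^ 2).
  { intros i Hi; specialize (H i Hi); apply Rabs_def2 in H; nra. }
  pose proof (S 0%nat ltac:(repeat constructor)); pose proof (S 1%nat ltac:(repeat constructor));
  pose proof (S 2%nat ltac:(repeat constructor)); pose proof (S 3%nat ltac:(repeat constructor));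
  pose proof (S 4%nat ltac:(repeat constructor)); pose proof (S 5%nat ltac:(repeat constructor)).
  nra.
Qed.

Lemma cont_curve_snbhd (g : R -> state) (t : R) :
  cont_curve g t -> filterlim g (locally t) (snbhd (g t)).
Proof.
  intros Hg P [e [He HP]].
  assert (He3 : 0 < e / 3) by lra.
  assert (L : forall i,
    locally t (fun s => Rabs (coord i (g s) - coord i (g t)) < e / 3)).
  { intros i.
    exact (proj1 (filterlim_locally _ _) (Hg i) (mkposreal _ He3)). }
  unfold filtermap.
  generalize (filter_and _ _ (L 0%nat) (filter_and _ _ (L 1%nat)
    (filter_and _ _ (L 2%nat) (filter_and _ _ (L 3%nat)
    (filter_and _ _ (L 4%nat) (L 5%nat)))))).
  apply filter_imp; intros s (h0 & h1 & h2 & h3 & h4 & h5).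
  apply HP, sdist_lt_coords; [exact He|].
  intros i _; destruct i as [|[|[|[|[|i]]]]]; assumption.
Qed.

Lemma scont_curve (f : state -> R) (g : R -> state) (t : R) :
  cont_curve g t -> scont f (g t) -> continuous (fun s => f (g s)) t.
Proof.
  intros Hg Hf; eapply filterlim_comp; [now apply cont_curve_snbhd | exact Hf].
Qed.

(** * Compactness *)

(** A cover of [K] by balls on which [P] holds has a finite subcover, and [P K] is assembled from it
    by unions and subsets. Later arguments only check [P] locally. *)
Lemma compact_induction (K : state -> Prop) (P : (state -> Prop) -> Prop) :
  scompact K ->
  P (fun _ => False) ->
  (forall A B : state -> Prop, (forall p, A p -> B p) -> P B -> P A) ->
  (forall A B, P A -> P B -> P (fun p => A p \/ B p)) ->
  (forall p, K p -> exists e, 0 < e /\ P (fun q => sdist p q < e)) ->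
  P K.
Proof.
  intros HK H0 Hsub Hcup Hloc.
  (* An index carries its center, its radius and the proof of [P] for its ball, so every member of
     the cover is good. Membership is phrased with [sqdist], whose continuity makes the balls
     open. *)
  set (I := {i : state * R | 0 < snd i /\ P (fun q => sdist (fst i) q < snd i)}).
  set (O := fun (i : I) q => sqdist q (fst (proj1_sig i)) < snd (proj1_sig i) ^ 2).
  destruct (HK I O) as [l Hl].
  - intros i p Hp; exact (scont_lt _ _ _ (scont_sqdist _ p) Hp).
  - intros p Hp; destruct (Hloc p Hp) as [e [He HPe]].
    exists (exist _ (p, e) (conj He HPe)); unfold O; simpl.
    rewrite sqdist_refl; nra.
  - apply (Hsub _ (fun p => exists i, In i l /\ O i p)); [exact Hl|].
    clear Hl; induction l as [|i l IH].
    + apply (Hsub _ (fun _ => False)); [intros p [i [[] _]] | exact H0].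
    + apply (Hsub _ (fun p => sdist (fst (proj1_sig i)) p < snd (proj1_sig i)
        \/ exists i, In i l /\ O i p)).
      * intros p [j [[<- | Hj] Hp]]; [left | right; eauto].
        apply sdist_lt; [apply (proj2_sig i)|]; rewrite sqdist_sym; exact Hp.
      * apply Hcup; [apply (proj2_sig i) | exact IH].
Qed.

(** Near each point [f] exceeds half its value there, and the smaller of two lower bounds serves a
    union. Asking for a positive bound instead of a minimiser covers the empty set too. *)
Lemma compact_pos_min (K : state -> Prop) (f : state -> R) :
  scompact K -> (forall p, K p -> scont f p) -> (forall p, K p -> 0 < f p) ->
  exists m, 0 < m /\ forall p, K p -> m <= f p.
Proof.
  intros HK Hf Hpos.
  apply (compact_induction K (fun A => exists m, 0 < m /\ forall p, A p -> m <= f p)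
    HK).
  - exists 1; split; [lra | intros _ []].
  - intros A B HAB [m [Hm H]]; exists m; auto.
  - intros A B [m [Hm HA]] [n [Hn HB]]; exists (Rmin m n).
    split; [now apply Rmin_pos|].
    intros p [Hp|Hp];
      [apply Rle_trans with m | apply Rle_trans with n];
      auto using Rmin_l, Rmin_r.
  - intros p Hp; specialize (Hpos p Hp).
    destruct (scont_gt f (f p / 2) p (Hf p Hp)) as [e [He H]]; [lra|].
    exists e; split; [exact He|]; exists (f p / 2); split; [lra|].
    intros q Hq; apply Rlt_le; auto.
Qed.

Definition sbounded (K : state -> Prop) : Prop :=
  exists M, forall p, K p -> forall i, Rabs (coord i p) <= M.

Definition sclosed (K : state -> Prop) : Prop :=
  forall p, ~ K p -> snbhd p (fun q => ~ K q).

(** A gauge on a box of dimension 6 assigns to a point of [K] a radius inside one member of the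
    cover, and to any other point a radius missing [K]. Finitely many gauge cubes cover the box,
    hence [K]. *)
Lemma heine_borel (K : state -> Prop) : sbounded K -> sclosed K -> scompact K.
Proof.
  intros [M HM] Hcl I O HO Hcov.
  set (st := fun u : Tn 6 R =>
    let '(a, (b, (c, (d, (e, (f, _)))))) := u in (mkv a b c, mkv d e f)).
  (* The radius is [3 * d] because coordinates within [d] give [sdist] below [3 * d]. *)
  set (good := fun (u : Tn 6 R) (d : posreal) => exists l, forall q,
    sdist (st u) q < 3 * d -> K q -> exists i, In i l /\ O i q).
  assert (Hgood : forall u, exists d, good u d).
  { intros u; destruct (classic (K (st u))) as [Hu|Hu].
    - destruct (Hcov _ Hu) as [i Hi]; destruct (HO i _ Hi) as [e [He H]].
      assert (He3 : 0 < e / 3) by lra.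
      exists (mkposreal _ He3), (i :: nil)%list; simpl; intros q Hq _.
      exists i; split; [now left|]; apply H; lra.
    - destruct (Hcl _ Hu) as [e [He H]].
      assert (He3 : 0 < e / 3) by lra.
      exists (mkposreal _ He3), nil; simpl; intros q Hq Kq.
      exfalso; apply (H q); [lra | exact Kq]. }
  set (delta := fun u => proj1_sig (constructive_indefinite_description _ (Hgood u))).
  assert (Hdelta : forall u, good u (delta u)) by (intros u; apply proj2_sig).
  clearbody delta.
  set (box := fun a : R => (a, (a, (a, (a, (a, (a, tt)))))) : Tn 6 R).
  (* [compactness_list] provides its finite list under a double negation only. *)
  apply NNPP; intros Hno.
  apply (compactness_list 6 (box (- M)) (box M) delta); intros [l Hl].
  apply Hno; clear Hno.
  assert (Hfin : exists l', forall q, K q ->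
    (exists u, In u l /\ sdist (st u) q < 3 * delta u) -> exists i, In i l' /\ O i q).
  { clear Hl; induction l as [|u l [l' IH]].
    - exists nil; intros q _ [u [[] _]].
    - destruct (Hdelta u) as [lu Hu]; exists (lu ++ l')%list.
      intros q Kq [w [[<- | Hw] Hq]].
      + destruct (Hu q Hq Kq) as [i [Hi Oi]]; exists i; rewrite in_app_iff; auto.
      + destruct (IH q Kq) as [i [Hi Oi]]; [eauto|].
        exists i; rewrite in_app_iff; auto. }
  destruct Hfin as [l' Hl']; exists l'; intros q Kq; apply Hl'; [exact Kq|].
  pose proof (HM q Kq) as B.
  assert (Bq : forall i, - M <= coord i q <= M) by (intros i; apply Rabs_le_between, B).
  destruct q as [[x1 x2 x3] [v1 v2 v3]].
  destruct (Hl (x1, (x2, (x3, (v1, (v2, (v3, tt))))))) as [u [Hu [_ Hc]]].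
  - simpl; repeat split; first
      [ apply (Bq 0%nat) | apply (Bq 1%nat) | apply (Bq 2%nat)
      | apply (Bq 3%nat) | apply (Bq 4%nat) | apply (Bq 5%nat) ].
  - exists u; split; [exact Hu|].
    set (d := delta u) in *; destruct u as (a & b & c & e & f & g & []).
    simpl in Hc; destruct Hc as (h1 & h2 & h3 & h4 & h5 & h6 & _).
    pose proof (cond_pos d).
    apply sdist_lt_coords; [lra|].
    replace (3 * d / 3) with (pos d) by field.
    intros i _; destruct i as [|[|[|[|[|i]]]]]; simpl; assumption.
Qed.

Lemma sbounded_mono (A B : state -> Prop) :
  (forall p, A p -> B p) -> sbounded B -> sbounded A.
Proof. intros HAB [M HM]; exists M; auto. Qed.

(** Relative closedness of [B] is the useful form: conditions on [Vfun] are continuous only where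
    [x] is nonzero, and [A] will be a set inside the domain. *)
Lemma sclosed_and (A B : state -> Prop) :
  sclosed A -> (forall p, A p -> ~ B p -> snbhd p (fun q => ~ B q)) ->
  sclosed (fun p => A p /\ B p).
Proof.
  intros HA HB p Hp; destruct (classic (A p)) as [Ap|Ap].
  - generalize (HB p Ap (fun Bp => Hp (conj Ap Bp))).
    apply filter_imp; tauto.
  - generalize (HA p Ap); apply filter_imp; tauto.
Qed.

Lemma snbhd_not_le (f : state -> R) (a : R) (p : state) :
  scont f p -> ~ f p <= a -> snbhd p (fun q => ~ f q <= a).
Proof.
  intros Hf Hp; generalize (scont_gt f a p Hf ltac:(lra)).
  apply filter_imp; intros; lra.
Qed.

Lemma snbhd_not_ge (f : state -> R) (a : R) (p : state) :
  scont f p -> ~ a <= f p -> snbhd p (fun q => ~ a <= f q).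
Proof.
  intros Hf Hp; generalize (scont_lt f a p Hf ltac:(lra)).
  apply filter_imp; intros; lra.
Qed.

(* [psi] is the minimum of finitely many functions [|p - q|^2 - d^2]. *)
Lemma compact_separating_function (Z W : state -> Prop) :
  scompact Z -> (forall p, Z p -> snbhd p W) ->
  exists psi : state -> R,
    (forall p, scont psi p) /\ (forall p, psi p <= 0 -> W p) /\
    sbounded (fun p => psi p <= 0) /\ (forall p, Z p -> psi p < 0).
Proof.
  intros HZ HW.
  apply (compact_induction Z (fun A => exists psi : state -> R,
    (forall p, scont psi p) /\ (forall p, psi p <= 0 -> W p) /\
    sbounded (fun p => psi p <= 0) /\ (forall p, A p -> psi p < 0)) HZ).
  - exists (fun _ => 1); split; [|split; [|split]].
    + intros p; apply scont_const.
    + intros; lra.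
    + exists 0; intros; lra.
    + intros p [].
  - intros A B HAB (psi & H1 & H2 & H3 & H4); exists psi.
    split; [exact H1 | split; [exact H2 | split; [exact H3 | auto]]].
  - intros A B (f & F1 & F2 & [M F3] & F4) (g & G1 & G2 & [N G3] & G4).
    assert (D : forall a b, Rmin a b <= 0 -> a <= 0 \/ b <= 0).
    { intros a b; unfold Rmin; destruct (Rle_dec a b); tauto. }
    exists (fun p => Rmin (f p) (g p)); split; [|split; [|split]].
    + intros p; now apply scont_min.
    + intros p Hp; destruct (D _ _ Hp); auto.
    + exists (Rmax M N); intros p Hp i; destruct (D _ _ Hp);
        [apply Rle_trans with M | apply Rle_trans with N];
        auto using Rmax_l, Rmax_r.
    + intros p [Hp|Hp]; [eapply Rle_lt_trans; [apply Rmin_l | auto]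
        | eapply Rle_lt_trans; [apply Rmin_r | auto]].
  - intros p Hp; destruct (HW p Hp) as [e [He H]].
    (* Halving the radius puts the closed ball, where the new function is nonpositive, inside the
       open ball contained in [W]. *)
    assert (Hin : forall q, sqdist q p - (e / 2) ^ 2 <= 0 -> sdist p q < e).
    { intros q Hq; apply sdist_lt; [exact He|]; rewrite sqdist_sym; nra. }
    exists (e / 2); split; [lra|].
    exists (fun q => sqdist q p - (e / 2) ^ 2); split; [|split; [|split]].
    + intros q; apply scont_minus; [apply scont_sqdist | apply scont_const].
    + intros q Hq; apply H, Hin, Hq.
    + exists (e + (Rabs (coord 0 p) + Rabs (coord 1 p) + Rabs (coord 2 p)
        + Rabs (coord 3 p) + Rabs (coord 4 p) + Rabs (coord 5 p))).
      intros q Hq i.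
      pose proof (coord_le_sdist i p q) as Hi; pose proof (Hin q Hq).
      pose proof (Rabs_triang (coord i q - coord i p) (coord i p)) as T.
      replace (coord i q - coord i p + coord i p) with (coord i q) in T by ring.
      rewrite Rabs_minus_sym in Hi.
      pose proof (Rabs_pos (coord 0 p)); pose proof (Rabs_pos (coord 1 p));
      pose proof (Rabs_pos (coord 2 p)); pose proof (Rabs_pos (coord 3 p));
      pose proof (Rabs_pos (coord 4 p)); pose proof (Rabs_pos (coord 5 p)).
      destruct i as [|[|[|[|[|i]]]]]; simpl in *; lra.
    + intros q Hq; apply sdist_lt in Hq; [|lra]; rewrite sqdist_sym in Hq; lra.
Qed.

(** * Global solutions of bounded Lipschitz systems *)

Lemma Rmax_0_lipschitz (s t : R) : Rabs (Rmax s 0 - Rmax t 0) <= Rabs (s - t).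
Proof.
  pose proof (Rle_abs (s - t)); pose proof (Rle_abs (t - s)) as H'.
  rewrite Rabs_minus_sym in H'; apply Rabs_le.
  unfold Rmax; destruct (Rle_dec s 0), (Rle_dec t 0); lra.
Qed.

Lemma continuous_Rmax_0 (t : R) : continuous (fun s => Rmax s 0) t.
Proof.
  apply filterlim_locally; intros eps; exists eps; intros s Hs.
  change (Rabs (Rmax s 0 - Rmax t 0) < eps).
  change (Rabs (s - t) < eps) in Hs.
  eapply Rle_lt_trans; [apply Rmax_0_lipschitz | exact Hs].
Qed.

Lemma lipschitz_continuous (f : R -> R) (B t : R) :
  (forall s u, Rabs (f s - f u) <= B * Rabs (s - u)) -> continuous f t.
Proof.
  intros Hf; apply filterlim_locally; intros eps.
  assert (Hd : 0 < eps / (Rabs B + 1)).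
  { apply Rdiv_lt_0_compat; [apply cond_pos | pose proof (Rabs_pos B); lra]. }
  exists (mkposreal _ Hd); intros s Hs.
  change (Rabs (s - t) < eps / (Rabs B + 1)) in Hs.
  change (Rabs (f s - f t) < eps).
  pose proof (Rabs_pos B); pose proof (Rle_abs B); pose proof (Rabs_pos (s - t)).
  eapply Rle_lt_trans; [apply Hf|].
  apply Rmult_lt_compat_r with (r := Rabs B + 1) in Hs; [|lra].
  unfold Rdiv in Hs; rewrite Rmult_assoc, Rinv_l in Hs by lra.
  nra.
Qed.

(** The bound on [h] is the derivative of [A * exp (2 * L * s)]. The factor [2 * L] gained by
    integration is what makes the Picard map a contraction. *)
Lemma RInt_exp_bound (h : R -> R) (A L t : R) :
  0 < L -> 0 <= A -> 0 <= t -> (forall s, continuous h s) ->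
  (forall s, 0 <= s -> Rabs (h s) <= 2 * L * A * exp (2 * L * s)) ->
  Rabs (RInt h 0 t) <= A * exp (2 * L * t).
Proof.
  intros HL HA Ht Hc Hb.
  apply Rle_trans with (A * exp (2 * L * t) - A * exp (2 * L * 0)).
  - apply (norm_RInt_le h (fun s => 2 * L * A * exp (2 * L * s)) 0 t).
    + exact Ht.
    + intros s Hs; apply Hb; lra.
    + apply (@RInt_correct R_CompleteNormedModule).
      apply (@ex_RInt_continuous R_CompleteNormedModule); auto.
    + apply (is_RInt_derive (fun s => A * exp (2 * L * s))).
      * intros s _; auto_derive; [trivial | ring].
      * intros s _; apply (@ex_derive_continuous R_AbsRing R_NormedModule).
        auto_derive; trivial.
  - rewrite Rmult_0_r, exp_0; lra.
Qed.

Section Picard.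

Variables (I : Type) (f : I -> (I -> R) -> R) (p : I -> R) (B L : R).
Hypothesis HL : 1 <= L.
Hypothesis f_bounded : forall i y, Rabs (f i y) <= B.
Hypothesis f_lipschitz : forall i y z d,
  (forall j, Rabs (y j - z j) <= d) -> Rabs (f i y - f i z) <= L * d.
Hypothesis f_continuous : forall i (y : I -> R -> R) t,
  (forall j, continuous (y j) t) -> continuous (fun s => f i (fun j => y j s)) t.

(* Freezing the right-hand side at negative times keeps it continuous on the
   whole line, while all estimates are only needed for nonnegative times. *)
Definition picard_rhs (y : I -> R -> R) (i : I) (s : R) : R :=
  f i (fun j => y j (Rmax s 0)).

Fixpoint picard (n : nat) : I -> R -> R :=
  match n with
  | O => fun i _ => p i
  | S n => fun i t => p i + RInt (picard_rhs (picard n) i) 0 t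
  end.

Lemma picard_rhs_continuous (y : I -> R -> R) (i : I) (t : R) :
  (forall j s, continuous (y j) s) -> continuous (picard_rhs y i) t.
Proof.
  intros Hy; apply (f_continuous i (fun j s => y j (Rmax s 0))); intros j.
  apply (continuous_comp (fun s => Rmax s 0) (y j)); auto using continuous_Rmax_0.
Qed.

Lemma picard_rhs_integrable (y : I -> R -> R) (i : I) (a b : R) :
  (forall j s, continuous (y j) s) -> ex_RInt (picard_rhs y i) a b.
Proof.
  intros Hy; apply (@ex_RInt_continuous R_CompleteNormedModule).
  intros; now apply picard_rhs_continuous.
Qed.

Lemma picard_int_lipschitz (y : I -> R -> R) (i : I) (s u : R) :
  (forall j s, continuous (y j) s) ->
  Rabs (p i + RInt (picard_rhs y i) 0 s - (p i + RInt (picard_rhs y i) 0 u))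
    <= B * Rabs (s - u).
Proof.
  intros Hy.
  assert (W : forall s u, u <= s ->
    Rabs (p i + RInt (picard_rhs y i) 0 s - (p i + RInt (picard_rhs y i) 0 u))
      <= B * Rabs (s - u)).
  { intros s' u' H.
    assert (C : RInt (picard_rhs y i) 0 u' + RInt (picard_rhs y i) u' s'
      = RInt (picard_rhs y i) 0 s')
      by (apply (RInt_Chasles (picard_rhs y i)); now apply picard_rhs_integrable).
    replace (p i + RInt (picard_rhs y i) 0 s' - (p i + RInt (picard_rhs y i) 0 u'))
      with (RInt (picard_rhs y i) u' s' : R) by lra.
    rewrite (Rabs_pos_eq (s' - u')), Rmult_comm by lra.
    apply abs_RInt_le_const; [lra | now apply picard_rhs_integrable|].
    intros; apply f_bounded. }
  destruct (Rle_dec u s); [auto|].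
  rewrite Rabs_minus_sym, (Rabs_minus_sym s u); apply W; lra.
Qed.

(** An index is demanded because [I] may be empty, and then [f_bounded] says nothing about [B]. *)
Lemma bound_ge0 : I -> 0 <= B.
Proof. intros i; eapply Rle_trans; [apply Rabs_pos | apply (f_bounded i p)]. Qed.

(** The constant [B] is independent of [n], so it survives the limit and yields continuity of the
    limit. *)
Lemma picard_lipschitz (n : nat) (i : I) (s u : R) :
  Rabs (picard n i s - picard n i u) <= B * Rabs (s - u).
Proof.
  revert i s u; induction n as [|n IH]; intros i s u; simpl.
  - replace (p i - p i) with 0 by ring; rewrite Rabs_R0.
    apply Rmult_le_pos; [exact (bound_ge0 i) | apply Rabs_pos].
  - apply picard_int_lipschitz; intros j t.
    apply (lipschitz_continuous _ B); apply IH.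
Qed.

Lemma picard_continuous (n : nat) (i : I) (t : R) : continuous (picard n i) t.
Proof. apply (lipschitz_continuous _ B), picard_lipschitz. Qed.

(** The Lipschitz constant [L] against the exponent [2 * L] halves the distance in the norm weighted
    by [exp (- 2 * L * t)]. This holds on the whole half-line at once, so no local solutions have to
    be glued. *)
Lemma picard_int_contraction (y z : I -> R -> R) (i : I) (A t : R) :
  (forall j s, continuous (y j) s) -> (forall j s, continuous (z j) s) ->
  0 <= A -> 0 <= t ->
  (forall j s, 0 <= s -> Rabs (y j s - z j s) <= 2 * A * exp (2 * L * s)) ->
  Rabs (p i + RInt (picard_rhs y i) 0 t - (p i + RInt (picard_rhs z i) 0 t))
    <= A * exp (2 * L * t).
Proof.
  intros Hy Hz HA Ht Hyz.
  assert (C : RInt (fun s => picard_rhs y i s - picard_rhs z i s) 0 t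
    = RInt (picard_rhs y i) 0 t - RInt (picard_rhs z i) 0 t)
    by (apply (RInt_minus (picard_rhs y i) (picard_rhs z i));
        now apply picard_rhs_integrable).
  replace (p i + RInt (picard_rhs y i) 0 t - (p i + RInt (picard_rhs z i) 0 t))
    with (RInt (fun s => picard_rhs y i s - picard_rhs z i s) 0 t : R) by lra.
  apply RInt_exp_bound; try lra.
  - intros s; apply (@continuous_minus R_UniformSpace R_AbsRing R_NormedModule);
      now apply picard_rhs_continuous.
  - intros s Hs; unfold picard_rhs; rewrite Rmax_left by lra.
    replace (2 * L * A * exp (2 * L * s)) with (L * (2 * A * exp (2 * L * s))) by ring.
    apply f_lipschitz; intros j; auto.
Qed.

Lemma picard_step (n : nat) (i : I) (t : R) :
  0 <= t -> Rabs (picard (S n) i t - picard n i t) <= B * (/ 2) ^ n * exp (2 * L * t).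
Proof.
  intros Ht; pose proof (bound_ge0 i) as HB.
  revert i t Ht; induction n as [|n IH]; intros i t Ht.
  - assert (E : picard 1 i t - picard 0 i t = RInt (picard_rhs (picard 0) i) 0 t).
    { apply Rplus_minus_l. }
    rewrite E.
    apply Rle_trans with ((t - 0) * B).
    + apply abs_RInt_le_const; [exact Ht | |intros; apply f_bounded].
      apply picard_rhs_integrable, picard_continuous.
    (* Here [1 <= L] matters: [t <= 1 + 2 * L * t <= exp (2 * L * t)]. *)
    + pose proof (exp_ineq1_le (2 * L * t)); simpl.
      assert (t <= exp (2 * L * t)) by nra; nra.
  - apply (picard_int_contraction (picard (S n)) (picard n) i (B * (/ 2) ^ S n) t);
      auto using picard_continuous.
    + apply Rmult_le_pos; [exact HB | apply pow_le; lra].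
    + intros j s Hs; eapply Rle_trans; [now apply IH|].
      apply Req_le; simpl; field.
Qed.

(** The difference of powers is the exact value of the partial geometric sum, which lets the
    induction on [m] close. *)
Lemma picard_cauchy (n m : nat) (i : I) (t : R) :
  0 <= t ->
  Rabs (picard (n + m) i t - picard n i t)
    <= 2 * B * ((/ 2) ^ n - (/ 2) ^ (n + m)) * exp (2 * L * t).
Proof.
  intros Ht; induction m as [|m IH].
  - rewrite Nat.add_0_r; unfold Rminus; rewrite !Rplus_opp_r, Rabs_R0; lra.
  - rewrite Nat.add_succ_r.
    pose proof (picard_step (n + m) i t Ht) as H.
    pose proof (Rabs_triang (picard (S (n + m)) i t - picard (n + m) i t)
      (picard (n + m) i t - picard n i t)) as T.
    replace (picard (S (n + m)) i t - picard (n + m) i t +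
      (picard (n + m) i t - picard n i t)) with
      (picard (S (n + m)) i t - picard n i t) in T by ring.
    eapply Rle_trans; [exact T|].
    replace ((/ 2) ^ S (n + m)) with (/ 2 * (/ 2) ^ (n + m)) by reflexivity.
    lra.
Qed.

Lemma picard_cauchy_bound (n m : nat) (i : I) (t : R) :
  0 <= t ->
  Rabs (picard (n + m) i t - picard n i t) <= 2 * B * (/ 2) ^ n * exp (2 * L * t).
Proof.
  intros Ht; eapply Rle_trans; [now apply picard_cauchy|].
  apply Rmult_le_compat_r; [apply Rlt_le, exp_pos|].
  apply Rmult_le_compat_l; [pose proof (bound_ge0 i); lra|].
  pose proof (pow_le (/ 2) (n + m) ltac:(lra)); lra.
Qed.

Lemma half_pow_small (C eps : R) : 0 < eps -> exists n, C * (/ 2) ^ n < eps.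
Proof.
  intros He.
  assert (Hl : is_lim_seq (fun n => C * (/ 2) ^ n) 0).
  { replace (Finite 0) with (Rbar_mult C 0) by (simpl; f_equal; ring).
    apply is_lim_seq_scal_l, is_lim_seq_geom; rewrite Rabs_pos_eq; lra. }
  apply is_lim_seq_spec in Hl; destruct (Hl (mkposreal _ He)) as [N HN].
  exists N; specialize (HN N (Nat.le_refl N)); simpl in HN.
  apply Rabs_def2 in HN; lra.
Qed.

Lemma half_pow_bound_eq0 (x C : R) :
  (forall n, Rabs x <= C * (/ 2) ^ n) -> x = 0.
Proof.
  intros H; destruct (Req_dec x 0) as [|Hx]; [assumption|].
  destruct (half_pow_small C (Rabs x)) as [n Hn]; [now apply Rabs_pos_lt|].
  specialize (H n); lra.
Qed.

(** The limit is taken at [Rmax t 0]: it is frozen at negative times, and the estimates for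
    nonnegative times then apply to every [t]. *)
Lemma picard_limit :
  exists y : I -> R -> R, forall i t,
    (forall n, Rabs (picard n i (Rmax t 0) - y i t)
       <= 2 * B * (/ 2) ^ n * exp (2 * L * Rmax t 0)) /\
    forall s, Rabs (y i s - y i t) <= B * Rabs (Rmax s 0 - Rmax t 0).
Proof.
  assert (Hlim : forall i t, is_lim_seq (fun n => picard n i (Rmax t 0))
    (Finite (real (Lim_seq (fun n => picard n i (Rmax t 0)))))).
  { intros i t; apply Lim_seq_correct', ex_lim_seq_cauchy_corr; intros eps.
    set (C := 2 * B * exp (2 * L * Rmax t 0)).
    destruct (half_pow_small C (eps / 2)) as [N HN];
      [pose proof (cond_pos eps); lra|].
    exists N; intros n m Hn Hm.
    assert (D : forall k, (N <= k)%nat ->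
      Rabs (picard k i (Rmax t 0) - picard N i (Rmax t 0)) < eps / 2).
    { intros k Hk; replace k with (N + (k - N))%nat by (rewrite Nat.add_comm; now apply Nat.sub_add).
      eapply Rle_lt_trans; [|exact HN].
      eapply Rle_trans; [apply picard_cauchy_bound, Rmax_r|].
      apply Req_le; unfold C; ring. }
    pose proof (D n Hn) as Dn; pose proof (D m Hm) as Dm.
    apply Rabs_def2 in Dn; apply Rabs_def2 in Dm; apply Rabs_def1; lra. }
  exists (fun i t => real (Lim_seq (fun n => picard n i (Rmax t 0)))); intros i t; split.
  - intros n; rewrite Rabs_minus_sym.
    apply (is_lim_seq_le
      (fun m => Rabs (picard (n + m) i (Rmax t 0) - picard n i (Rmax t 0)))
      (fun _ => 2 * B * (/ 2) ^ n * exp (2 * L * Rmax t 0))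
      (Finite _) (Finite _)).
    + intros m; apply picard_cauchy_bound, Rmax_r.
    + apply (is_lim_seq_abs _ (Finite _)), is_lim_seq_minus'; [|apply is_lim_seq_const].
      apply (is_lim_seq_ext (fun m => picard (m + n) i (Rmax t 0))).
      { intros m; now rewrite Nat.add_comm. }
      apply (is_lim_seq_incr_n (fun m => picard m i (Rmax t 0))), Hlim.
    + apply is_lim_seq_const.
  - intros s.
    apply (is_lim_seq_le
      (fun m => Rabs (picard m i (Rmax s 0) - picard m i (Rmax t 0)))
      (fun _ => B * Rabs (Rmax s 0 - Rmax t 0)) (Finite _) (Finite _)).
    + intros m; apply picard_lipschitz.
    + apply (is_lim_seq_abs _ (Finite _)), is_lim_seq_minus'; apply Hlim.
    + apply is_lim_seq_const.
Qed.

Theorem picard_global :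
  exists y : I -> R -> R, (forall i, y i 0 = p i) /\
    forall i t, is_derive (y i) t (f i (fun j => y j (Rmax t 0))).
Proof.
  destruct picard_limit as [y Hy].
  assert (Yc : forall j s, continuous (y j) s).
  { intros j; intros s.
    assert (HB : 0 <= B) by exact (bound_ge0 j).
    apply (lipschitz_continuous _ B); intros u t.
    eapply Rle_trans; [apply Hy|].
    apply Rmult_le_compat_l; [exact HB | apply Rmax_0_lipschitz]. }
  (* Being frozen at negative times, [y] may fail to have a two-sided derivative at 0. Its integral
     [z] agrees with [y] for [0 <= t] and is differentiable on the whole line, so [z] is the
     solution returned. *)
  set (z := fun i t => p i + RInt (picard_rhs y i) 0 t).
  assert (Hyz : forall i t, 0 <= t -> y i t = z i t).
  { intros i t Ht; pose proof (bound_ge0 i) as HB; apply Rminus_diag_uniq.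
    (* Iterate [S n] is close to [y] by convergence, and to [z] because the Picard map halves the
       distance between iterate [n] and [y]; each error is at most
       [B * (/ 2) ^ n * exp (2 * L * t)]. *)
    apply half_pow_bound_eq0 with (C := 2 * B * exp (2 * L * t)); intros n.
    destruct (Hy i t) as [H1 _]; specialize (H1 (S n)).
    rewrite Rmax_left in H1 by lra.
    assert (H2 : Rabs (picard (S n) i t - z i t) <= B * (/ 2) ^ n * exp (2 * L * t)).
    { apply (picard_int_contraction (picard n) y i (B * (/ 2) ^ n) t); auto using picard_continuous.
      - apply Rmult_le_pos; [exact HB | apply pow_le; lra].
      - intros j s Hs; destruct (Hy j s) as [H _]; specialize (H n).
        rewrite Rmax_left in H by lra; lra. }
    pose proof (Rabs_triang (y i t - picard (S n) i t) (picard (S n) i t - z i t)) as T.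
    rewrite (Rabs_minus_sym (y i t)) in T.
    replace (y i t - picard (S n) i t + (picard (S n) i t - z i t))
      with (y i t - z i t) in T by ring.
    replace ((/ 2) ^ S n) with (/ 2 * (/ 2) ^ n) in H1 by reflexivity.
    lra. }
  exists z; split.
  - intros i; unfold z; rewrite RInt_point; unfold zero; simpl; ring.
  - intros i t.
    assert (E : f i (fun j => z j (Rmax t 0)) = picard_rhs y i t).
    (* The Lipschitz bound with [d = 0] shows that [f] takes equal values at pointwise equal
       arguments. *)
    { apply Rminus_diag_uniq, half_pow_bound_eq0 with (C := 0); intros n.
      unfold picard_rhs; rewrite Rmult_0_l.
      apply Rle_trans with (L * 0); [|lra].
      apply f_lipschitz; intros j.
      rewrite Hyz by apply Rmax_r; unfold Rminus; rewrite Rplus_opp_r, Rabs_R0; lra. }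
    rewrite E; unfold z.
    replace (picard_rhs y i t) with (plus zero (picard_rhs y i t)) by apply plus_zero_l.
    apply (@is_derive_plus R_AbsRing R_NormedModule).
    + apply (@is_derive_const R_AbsRing R_NormedModule).
    + apply (is_derive_RInt _ _ 0); [|now apply picard_rhs_continuous].
      apply filter_forall; intros u.
      apply (@RInt_correct R_CompleteNormedModule), picard_rhs_integrable, Yc.
Qed.

End Picard.

(** * Algebras of scalar functions and vector operations *)

(** Continuity at a point and being bounded and Lipschitz are both closed under these operations, so
    the vector expressions are decomposed in the same way for both. *)
Record function_algebra (P : (state -> R) -> Prop) : Prop := {
  alg_const : forall a, P (fun _ => a);
  alg_plus : forall f g, P f -> P g -> P (fun q => f q + g q);
  alg_mult : forall f g, P f -> P g -> P (fun q => f q * g q)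
}.

Definition valg (P : (state -> R) -> Prop) (f : state -> vec3) : Prop :=
  P (fun q => c1 (f q)) /\ P (fun q => c2 (f q)) /\ P (fun q => c3 (f q)).

Section FunctionAlgebra.

Variable P : (state -> R) -> Prop.
Hypothesis HP : function_algebra P.

Lemma alg_minus (f g : state -> R) : P f -> P g -> P (fun q => f q - g q).
Proof.
  intros Hf Hg.
  assert (E : (fun q => f q - g q) = (fun q => f q + -1 * g q)).
  { apply FunctionalExtensionality.functional_extensionality; intros; ring. }
  rewrite E; apply (alg_plus P HP); [exact Hf|].
  apply (alg_mult P HP); [apply (alg_const P HP) | exact Hg].
Qed.

Lemma alg_pow (f : state -> R) (n : nat) : P f -> P (fun q => f q ^ n).
Proof.
  intros Hf; induction n; simpl;
    [apply (alg_const P HP) | now apply (alg_mult P HP)].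
Qed.

Lemma valg_const (a : vec3) : valg P (fun _ => a).
Proof. repeat split; apply (alg_const P HP). Qed.

Lemma valg_add (f g : state -> vec3) :
  valg P f -> valg P g -> valg P (fun q => vadd (f q) (g q)).
Proof.
  intros (? & ? & ?) (? & ? & ?); repeat split; simpl; now apply (alg_plus P HP).
Qed.

Lemma valg_scale (s : state -> R) (f : state -> vec3) :
  P s -> valg P f -> valg P (fun q => vscale (s q) (f q)).
Proof.
  intros Hs (? & ? & ?); repeat split; simpl; now apply (alg_mult P HP).
Qed.

Lemma valg_opp (f : state -> vec3) : valg P f -> valg P (fun q => vopp (f q)).
Proof. intros Hf; apply valg_scale; [apply (alg_const P HP) | exact Hf]. Qed.

Lemma valg_sub (f g : state -> vec3) :
  valg P f -> valg P g -> valg P (fun q => vsub (f q) (g q)).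
Proof. intros Hf Hg; apply valg_add; [exact Hf | now apply valg_opp]. Qed.

Lemma valg_dot (f g : state -> vec3) :
  valg P f -> valg P g -> P (fun q => vdot (f q) (g q)).
Proof.
  intros (? & ? & ?) (? & ? & ?).
  repeat apply (alg_plus P HP); now apply (alg_mult P HP).
Qed.

Lemma valg_cross (f g : state -> vec3) :
  valg P f -> valg P g -> valg P (fun q => vcross (f q) (g q)).
Proof.
  intros (? & ? & ?) (? & ? & ?); repeat split; simpl;
    apply alg_minus; now apply (alg_mult P HP).
Qed.

End FunctionAlgebra.

Lemma scont_algebra (p : state) : function_algebra (fun f => scont f p).
Proof.
  split; intros; [apply scont_const | now apply scont_plus | now apply scont_mult].
Qed.

(** * The gradient of [Vfun] *)

Definition sdot (p q : state) : R := vdot (fst p) (fst q) + vdot (snd p) (snd q).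

(* [u], [u1] and [s] stand for [U |x|], [U' |x|] and [1 / |x|]. *)
Definition grad_expr (k1 k2 E0 : R) (L0 x v : vec3) (u u1 s : R) : state :=
  let dE := / 2 * vdot v v + u - E0 in
  let dL := vsub (vcross x v) L0 in
  (vadd (vscale (k1 * dE * u1) (vscale s x)) (vscale k2 (vcross v dL)),
   vadd (vscale (k1 * dE) v) (vscale k2 (vcross dL x))).

(** With the radial values as separate arguments, clamped values can be substituted when the field
    is extended. *)
Definition field_expr (k1 k2 E0 : R) (L0 x v : vec3) (u u1 s : R) : state :=
  let dE := / 2 * vdot v v + u - E0 in
  let dL := vsub (vcross x v) L0 in
  let n := vscale s x in
  (vsub (vsub v (vscale (k1 * dE * u1) n)) (vscale k2 (vcross v dL)),
   vsub (vsub (vopp (vscale u1 n)) (vscale (k1 * dE) v)) (vscale k2 (vcross dL x))).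

Definition gradV (U U1 : R -> R) (k1 k2 E0 : R) (L0 : vec3) (p : state) : state :=
  grad_expr k1 k2 E0 L0 (fst p) (snd p)
    (U (vnorm (fst p))) (U1 (vnorm (fst p))) (/ vnorm (fst p)).

Ltac valg_tac HP :=
  repeat lazymatch goal with
  | |- valg _ _ => first
    [ assumption | apply (valg_const _ HP) | apply (valg_sub _ HP)
    | apply (valg_add _ HP) | apply (valg_opp _ HP) | apply (valg_scale _ HP)
    | apply (valg_cross _ HP) ]
  | |- _ => first
    [ assumption
    | lazymatch goal with
      | |- context [fun q : state => vdot (@?f q) (@?g q)] => apply (valg_dot _ HP f g)
      | |- context [fun q : state => @?f q - @?g q] => apply (alg_minus _ HP f g)
      | |- context [fun q : state => @?f q + @?g q] => apply (alg_plus _ HP f g)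
      | |- context [fun q : state => @?f q * @?g q] => apply (alg_mult _ HP f g)
      | |- context [fun q : state => @?f q ^ ?n] => apply (alg_pow _ HP f n)
      | |- _ => apply (alg_const _ HP)
      end ]
  end.

Lemma field_expr_algebra (P : (state -> R) -> Prop) (k1 k2 E0 : R) (L0 : vec3)
  (x v : state -> vec3) (u u1 s : state -> R) :
  function_algebra P -> valg P x -> valg P v -> P u -> P u1 -> P s ->
  forall i, P (fun q => coord i (field_expr k1 k2 E0 L0 (x q) (v q) (u q) (u1 q) (s q))).
Proof.
  intros HP Hx Hv Hu Hu1 Hs.
  set (F := fun q => field_expr k1 k2 E0 L0 (x q) (v q) (u q) (u1 q) (s q)).
  assert (H1 : valg P (fun q => fst (F q))) by (unfold F; cbn [fst field_expr]; valg_tac HP).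
  assert (H2 : valg P (fun q => snd (F q))) by (unfold F; cbn [snd field_expr]; valg_tac HP).
  destruct H1 as (? & ? & ?), H2 as (? & ? & ?).
  intros [|[|[|[|[|i]]]]]; assumption.
Qed.

Lemma grad_expr_algebra (P : (state -> R) -> Prop) (k1 k2 E0 : R) (L0 : vec3)
  (x v : state -> vec3) (u u1 s : state -> R) :
  function_algebra P -> valg P x -> valg P v -> P u -> P u1 -> P s ->
  P (fun q => let G := grad_expr k1 k2 E0 L0 (x q) (v q) (u q) (u1 q) (s q) in
              sdot G G).
Proof.
  intros HP Hx Hv Hu Hu1 Hs; unfold sdot; cbn [fst snd grad_expr]; valg_tac HP.
Qed.

Lemma vdot_self_ge0 (a : vec3) : 0 <= vdot a a.
Proof. unfold vdot; nra. Qed.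

Lemma vdot_self_eq0 (a : vec3) : vdot a a = 0 -> a = vzero.
Proof.
  destruct a as [a b c]; unfold vdot; simpl; intros H.
  assert (a = 0) by nra; assert (b = 0) by nra; assert (c = 0) by nra.
  subst; reflexivity.
Qed.

Lemma vdot_self_pos (a : vec3) : a <> vzero -> 0 < vdot a a.
Proof.
  intros Ha; destruct (vdot_self_ge0 a) as [H|H]; [exact H|].
  exfalso; apply Ha, vdot_self_eq0; auto.
Qed.

Lemma vzero_dot : vdot vzero vzero = 0.
Proof. unfold vdot, vzero; simpl; ring. Qed.

Lemma vnorm_pos (a : vec3) : a <> vzero -> 0 < vnorm a.
Proof. intros Ha; apply sqrt_lt_R0, vdot_self_pos, Ha. Qed.

Lemma vnorm_sqr (a : vec3) : vnorm a * vnorm a = vdot a a.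
Proof. apply sqrt_sqrt, vdot_self_ge0. Qed.

Lemma vsub_eq0 (a b : vec3) : vsub a b = vzero -> a = b.
Proof.
  destruct a, b; unfold vsub, vadd, vopp, vscale, vzero; simpl; intros H.
  injection H; intros; f_equal; lra.
Qed.

Lemma vsub_diag (a : vec3) : vsub a a = vzero.
Proof.
  destruct a; unfold vsub, vadd, vopp, vscale, vzero; simpl; f_equal; ring.
Qed.

(** Splitting the curve into scalar functions gives [auto_derive] a form it can differentiate;
    [0 < r] makes the square root and [U] differentiable there. *)
Lemma Vfun_chain_coord (U U1 X1 X2 X3 Y1 Y2 Y3 : R -> R)
  (k1 k2 E0 l1 l2 l3 t d1 d2 d3 e1 e2 e3 : R) :
  is_derive X1 t d1 -> is_derive X2 t d2 -> is_derive X3 t d3 ->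
  is_derive Y1 t e1 -> is_derive Y2 t e2 -> is_derive Y3 t e3 ->
  let r := vnorm (mkv (X1 t) (X2 t) (X3 t)) in
  0 < r -> is_derive U r (U1 r) ->
  is_derive (fun s => Vfun U k1 k2 E0 (mkv l1 l2 l3)
      (mkv (X1 s) (X2 s) (X3 s), mkv (Y1 s) (Y2 s) (Y3 s))) t
    (sdot (gradV U U1 k1 k2 E0 (mkv l1 l2 l3)
      (mkv (X1 t) (X2 t) (X3 t), mkv (Y1 t) (Y2 t) (Y3 t)))
      (mkv d1 d2 d3, mkv e1 e2 e3)).
Proof.
  intros HX1 HX2 HX3 HY1 HY2 HY3 r Hr HU.
  assert (Hs : 0 < X1 t * X1 t + X2 t * X2 t + X3 t * X3 t).
  { pose proof (vnorm_sqr (mkv (X1 t) (X2 t) (X3 t))) as E; fold r in E.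
    unfold vdot in E; simpl in E; nra. }
  unfold sdot, gradV, grad_expr, Vfun, Energy, AngMom, vdot, vcross, vsub, vadd,
    vopp, vscale; cbn [fst snd c1 c2 c3].
  fold r.
  unfold vnorm, vdot in *; cbn [c1 c2 c3] in *.
  auto_derive.
  - repeat match goal with |- _ /\ _ => split end; trivial;
      try (eexists; eassumption).
  - rewrite (is_derive_unique (fun s : R => X1 s) _ _ HX1), (is_derive_unique (fun s : R => X2 s) _ _ HX2),
      (is_derive_unique (fun s : R => X3 s) _ _ HX3), (is_derive_unique (fun s : R => Y1 s) _ _ HY1),
      (is_derive_unique (fun s : R => Y2 s) _ _ HY2), (is_derive_unique (fun s : R => Y3 s) _ _ HY3).
    fold r; rewrite (is_derive_unique (fun s : R => U s) _ _ HU).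
    field; lra.
Qed.

Lemma Vfun_chain (U U1 : R -> R) (k1 k2 E0 : R) (L0 : vec3) (g : R -> state)
  (t : R) (d : state) :
  (forall r, 0 < r -> derivable_pt_lim U r (U1 r)) ->
  in_domain (g t) -> has_sderiv g t d ->
  derivable_pt_lim (fun s => Vfun U k1 k2 E0 L0 (g s)) t
    (sdot (gradV U U1 k1 k2 E0 L0 (g t)) d).
Proof.
  intros HU Hdom (H1 & H2 & H3 & H4 & H5 & H6).
  destruct L0 as [l1 l2 l3], d as [[d1 d2 d3] [e1 e2 e3]]; simpl in *.
  assert (Hg : forall s, g s = of_coords (fun i => coord i (g s)))
    by (intros; now rewrite of_coordsK).
  apply is_derive_Reals.
  apply (is_derive_ext (fun s => Vfun U k1 k2 E0 (mkv l1 l2 l3)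
    (of_coords (fun i => coord i (g s))))); [intros s; now rewrite <- Hg|].
  rewrite (Hg t); apply Vfun_chain_coord; try (apply is_derive_Reals; assumption).
  - apply vnorm_pos; unfold in_domain in Hdom; rewrite (Hg t) in Hdom; exact Hdom.
  - apply is_derive_Reals, HU, vnorm_pos.
    unfold in_domain in Hdom; rewrite (Hg t) in Hdom; exact Hdom.
Qed.

(* The uncontrolled part of the field is orthogonal to the gradient because
   [Energy] and [AngMom] are first integrals. *)
Lemma gradV_dot_field (U U1 : R -> R) (k1 k2 E0 : R) (L0 : vec3) (p : state) :
  let G := gradV U U1 k1 k2 E0 L0 p in
  sdot G (controlled_field U U1 k1 k2 E0 L0 p) = - sdot G G.
Proof.
  unfold sdot, gradV, grad_expr, controlled_field, Energy, AngMom.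
  generalize (U (vnorm (fst p))) (U1 (vnorm (fst p))) (/ vnorm (fst p)).
  intros u u1 s; destruct p as [[x1 x2 x3] [v1 v2 v3]], L0 as [l1 l2 l3].
  unfold vdot, vcross, vsub, vadd, vopp, vscale; simpl; ring.
Qed.

(** The derivative of [Vfun] in the direction of its own gradient is [sdot G G], and criticality
    makes it 0. *)
Lemma critical_gradV (U U1 : R -> R) (k1 k2 E0 : R) (L0 : vec3) (p : state) :
  (forall r, 0 < r -> derivable_pt_lim U r (U1 r)) -> in_domain p ->
  critical_point (Vfun U k1 k2 E0 L0) p ->
  let G := gradV U U1 k1 k2 E0 L0 p in sdot G G = 0.
Proof.
  intros HU Hp Hcrit G.
  set (g := fun t => sadd p (sscale t G)).
  assert (E : g 0 = p).
  { unfold g; destruct p as [[x1 x2 x3] [v1 v2 v3]].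
    unfold sadd, sscale, vadd, vscale; simpl.
    f_equal; f_equal; ring. }
  assert (Hd : has_sderiv g 0 G).
  { unfold g, has_sderiv, sadd, sscale, vadd, vscale; simpl.
    repeat split; apply is_derive_Reals; auto_derive; trivial; ring. }
  assert (H := Vfun_chain U U1 k1 k2 E0 L0 g 0 G HU
    ltac:(rewrite E; exact Hp) Hd).
  rewrite E in H.
  exact (uniqueness_limite _ _ _ _ H (Hcrit G)).
Qed.

(** * Critical points of [Vfun] near its zero set *)

(** A nonzero [w] would make [x] and [v] multiples of [w], hence parallel. Division is avoided by
    scaling with [ww = |w|^2]: [ww x = (w . x) w] and [ww v = (w . v) w], so [ww^2] annihilates the
    cross product of [x] and [v]. *)
Lemma parallel_to_both (x v w : vec3) :
  vcross v w = vzero -> vcross w x = vzero -> 0 < vdot (vcross x v) (vcross x v) ->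
  w = vzero.
Proof.
  destruct x as [x1 x2 x3], v as [v1 v2 v3], w as [w1 w2 w3].
  unfold vcross, vdot, vzero; simpl; intros H1 H2 HL.
  pose proof (f_equal c1 H1) as B1; pose proof (f_equal c2 H1) as B2;
  pose proof (f_equal c3 H1) as B3; pose proof (f_equal c1 H2) as A1;
  pose proof (f_equal c2 H2) as A2; pose proof (f_equal c3 H2) as A3.
  simpl in A1, A2, A3, B1, B2, B3.
  set (ww := w1 * w1 + w2 * w2 + w3 * w3).
  set (wx := w1 * x1 + w2 * x2 + w3 * x3).
  set (wv := w1 * v1 + w2 * v2 + w3 * v3).
  assert (X1 : ww * x1 = w1 * wx).
  { transitivity (w1 * wx + (w3 * (w3 * x1 - w1 * x3) - w2 * (w1 * x2 - w2 * x1))).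
    - unfold ww, wx; ring.
    - rewrite A2, A3; ring. }
  assert (X2 : ww * x2 = w2 * wx).
  { transitivity (w2 * wx + (w1 * (w1 * x2 - w2 * x1) - w3 * (w2 * x3 - w3 * x2))).
    - unfold ww, wx; ring.
    - rewrite A3, A1; ring. }
  assert (X3 : ww * x3 = w3 * wx).
  { transitivity (w3 * wx + (w2 * (w2 * x3 - w3 * x2) - w1 * (w3 * x1 - w1 * x3))).
    - unfold ww, wx; ring.
    - rewrite A1, A2; ring. }
  assert (V1 : ww * v1 = w1 * wv).
  { transitivity (w1 * wv - (w3 * (v3 * w1 - v1 * w3) - w2 * (v1 * w2 - v2 * w1))).
    - unfold ww, wv; ring.
    - rewrite B2, B3; ring. }
  assert (V2 : ww * v2 = w2 * wv).
  { transitivity (w2 * wv - (w1 * (v1 * w2 - v2 * w1) - w3 * (v2 * w3 - v3 * w2))).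
    - unfold ww, wv; ring.
    - rewrite B3, B1; ring. }
  assert (V3 : ww * v3 = w3 * wv).
  { transitivity (w3 * wv - (w2 * (v2 * w3 - v3 * w2) - w1 * (v3 * w1 - v1 * w3))).
    - unfold ww, wv; ring.
    - rewrite B1, B2; ring. }
  assert (L1 : ww * ww * (x2 * v3 - x3 * v2) = 0).
  { replace (ww * ww * (x2 * v3 - x3 * v2))
      with ((ww * x2) * (ww * v3) - (ww * x3) * (ww * v2)) by ring.
    rewrite X2, X3, V2, V3; ring. }
  assert (L2 : ww * ww * (x3 * v1 - x1 * v3) = 0).
  { replace (ww * ww * (x3 * v1 - x1 * v3))
      with ((ww * x3) * (ww * v1) - (ww * x1) * (ww * v3)) by ring.
    rewrite X1, X3, V1, V3; ring. }
  assert (L3 : ww * ww * (x1 * v2 - x2 * v1) = 0).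
  { replace (ww * ww * (x1 * v2 - x2 * v1))
      with ((ww * x1) * (ww * v2) - (ww * x2) * (ww * v1)) by ring.
    rewrite X1, X2, V1, V2; ring. }
  apply vdot_self_eq0; unfold vdot; simpl; fold ww.
  destruct (Req_dec ww 0) as [|Hw]; [assumption|].
  assert (Hww : ww * ww <> 0) by now apply Rmult_integral_contrapositive_currified.
  apply Rmult_integral in L1, L2, L3.
  destruct L1, L2, L3; try contradiction.
  exfalso; revert HL; rewrite H, H0, H3; lra.
Qed.

(* A nontrivial relation between the gradients of the energy and of the angular
   momentum forces a circular orbit: [x . v = 0] and [|v|^2 = r U'(r)], with
   [u = U'(r) / r]. *)
Lemma dependent_gradients_circular (x v w : vec3) (a u : R) :
  a <> 0 ->
  vadd (vscale (a * u) x) (vcross v w) = vzero ->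
  vadd (vscale a v) (vcross w x) = vzero ->
  vdot v v = u * vdot x x /\
  vdot (vcross x v) (vcross x v) = vdot x x * vdot v v.
Proof.
  destruct x as [x1 x2 x3], v as [v1 v2 v3], w as [w1 w2 w3].
  unfold vadd, vscale, vcross, vdot, vzero; simpl; intros Ha H1 H2.
  injection H1; injection H2; intros A3 A2 A1 B3 B2 B1.
  assert (Hxv : x1 * v1 + x2 * v2 + x3 * v3 = 0).
  { apply (Rmult_eq_reg_l a); [|exact Ha].
    (* The dot product of the second relation with [x] kills [vcross w x] and leaves
       [a (x . v) = 0]. *)
    assert (C : x1 * (a * v1 + (w2 * x3 - w3 * x2)) + x2 * (a * v2 + (w3 * x1 - w1 * x3))
      + x3 * (a * v3 + (w1 * x2 - w2 * x1)) = 0) by (rewrite A1, A2, A3; ring).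
    rewrite Rmult_0_r, <- C; ring. }
  split.
  - apply (Rmult_eq_reg_l a); [|exact Ha].
    (* The second relation is dotted with [v] and the first with [x]; in the difference the two
       triple products cancel. *)
    assert (C : v1 * (a * v1 + (w2 * x3 - w3 * x2)) + v2 * (a * v2 + (w3 * x1 - w1 * x3))
      + v3 * (a * v3 + (w1 * x2 - w2 * x1))
      - (x1 * (a * u * x1 + (v2 * w3 - v3 * w2)) + x2 * (a * u * x2 + (v3 * w1 - v1 * w3))
         + x3 * (a * u * x3 + (v1 * w2 - v2 * w1))) = 0)
      by (rewrite A1, A2, A3, B1, B2, B3; ring).
    apply Rminus_diag_uniq; rewrite <- C; ring.
  (* Lagrange's identity for the squared norm of a cross product, with [x . v = 0]. *)
  - assert (C : (x1 * v1 + x2 * v2 + x3 * v3) ^ 2 = 0) by (rewrite Hxv; ring).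
    apply Rminus_diag_uniq.
    replace 0 with (- (x1 * v1 + x2 * v2 + x3 * v3) ^ 2) by (rewrite C; ring).
    ring.
Qed.

(** It vanishes when the energy and squared angular momentum are those of a circular orbit at the
    radius of [p]. The sum of squares turns the exclusion of two simultaneous equations into one
    open condition. *)
Definition circular_defect (U U1 : R -> R) (p : state) : R :=
  let r := vnorm (fst p) in
  (Energy U p - (/ 2 * r * U1 r + U r)) ^ 2
  + (vdot (AngMom p) (AngMom p) - r ^ 3 * U1 r) ^ 2.

(** If the energy error [dE] is 0, [parallel_to_both] removes the angular momentum error as well. If
    not, the vanishing gradient is a nontrivial relation, and [dependent_gradients_circular] makes
    the circular defect 0. *)
Lemma gradV_eq0 (U U1 : R -> R) (k1 k2 E0 : R) (L0 : vec3) (p : state) :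
  0 < k1 -> 0 < k2 -> in_domain p -> 0 < vdot (AngMom p) (AngMom p) ->
  0 < circular_defect U U1 p ->
  sdot (gradV U U1 k1 k2 E0 L0 p) (gradV U U1 k1 k2 E0 L0 p) = 0 ->
  Vfun U k1 k2 E0 L0 p = 0.
Proof.
  intros Hk1 Hk2 Hp HL Hcirc HG.
  destruct p as [x v]; unfold in_domain in Hp; simpl in Hp.
  pose proof (vnorm_pos x Hp) as Hr; pose proof (vnorm_sqr x) as Hr2.
  unfold AngMom in HL; unfold circular_defect, Energy, AngMom in Hcirc.
  unfold Vfun, gradV, grad_expr, Energy, AngMom in *; cbn [fst snd] in *.
  set (r := vnorm x) in *.
  set (dE := / 2 * vdot v v + U r - E0) in *.
  set (dL := vsub (vcross x v) L0) in *.
  unfold sdot in HG; cbn [fst snd] in HG.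
  match type of HG with vdot ?A _ + vdot ?B _ = 0 =>
    assert (HA : A = vzero) by (apply vdot_self_eq0;
      pose proof (vdot_self_ge0 A); pose proof (vdot_self_ge0 B); lra);
    assert (HB : B = vzero) by (apply vdot_self_eq0;
      pose proof (vdot_self_ge0 A); pose proof (vdot_self_ge0 B); lra)
  end.
  set (w := vscale k2 dL).
  assert (HA' : vadd (vscale (k1 * dE * (U1 r * / r)) x) (vcross v w) = vzero).
  { rewrite <- HA; unfold w, vadd, vscale, vcross; simpl; f_equal; ring. }
  assert (HB' : vadd (vscale (k1 * dE) v) (vcross w x) = vzero).
  { rewrite <- HB; unfold w, vadd, vscale, vcross; simpl; f_equal; ring. }
  destruct (Req_dec dE 0) as [E|E].
  - rewrite E, Rmult_0_r in HA', HB'.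
    assert (Hw : w = vzero).
    { apply (parallel_to_both x v w); [| |exact HL].
      - rewrite <- HA'; unfold vadd, vscale, vcross; simpl; f_equal; ring.
      - rewrite <- HB'; unfold vadd, vscale, vcross; simpl; f_equal; ring. }
    assert (HdL : vdot dL dL = 0).
    { assert (C : vdot w w = k2 * k2 * vdot dL dL)
        by (unfold w, vdot, vscale; simpl; ring).
      rewrite Hw, vzero_dot in C; symmetry in C.
      apply Rmult_integral in C; destruct C as [C|C]; [nra | exact C]. }
    rewrite E, HdL; ring.
  - exfalso.
    destruct (dependent_gradients_circular x v w (k1 * dE) (U1 r * / r)) as [C1 C2];
      [nra | exact HA' | exact HB' |].
    rewrite C2, C1, <- Hr2 in Hcirc.
    replace (/ 2 * (U1 r * / r * (r * r)) + U r - (/ 2 * r * U1 r + U r))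
      with 0 in Hcirc by (field; lra).
    replace (r * r * (U1 r * / r * (r * r)) - r ^ 3 * U1 r) with 0 in Hcirc
      by (field; lra).
    lra.
Qed.

(** * Continuity of [Vfun] and its gradient *)

Lemma scont_fst (p : state) : valg (fun f => scont f p) fst.
Proof. repeat split; [apply (scont_coord 0) | apply (scont_coord 1) | apply (scont_coord 2)]. Qed.

Lemma scont_snd (p : state) : valg (fun f => scont f p) snd.
Proof. repeat split; [apply (scont_coord 3) | apply (scont_coord 4) | apply (scont_coord 5)]. Qed.

Lemma scont_vnorm (p : state) : scont (fun q => vnorm (fst q)) p.
Proof.
  apply (scont_comp sqrt (fun q => vdot (fst q) (fst q))).
  - apply (valg_dot _ (scont_algebra p)); apply scont_fst.
  - apply continuity_pt_sqrt, vdot_self_ge0.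
Qed.

Lemma derivable_continuity (h h' : R -> R) (r : R) :
  derivable_pt_lim h r (h' r) -> continuity_pt h r.
Proof. intros H; apply derivable_continuous_pt; exists (h' r); exact H. Qed.

Section Continuity.

Variables (U U1 U2 : R -> R).
Hypothesis HU : forall r, 0 < r -> derivable_pt_lim U r (U1 r).
Hypothesis HU1 : forall r, 0 < r -> derivable_pt_lim U1 r (U2 r).

Lemma scont_radial (h h' : R -> R) (p : state) :
  (forall r, 0 < r -> derivable_pt_lim h r (h' r)) -> in_domain p ->
  scont (fun q => h (vnorm (fst q))) p.
Proof.
  intros Hh Hp; apply scont_comp; [apply scont_vnorm|].
  apply (derivable_continuity h h'), Hh, vnorm_pos, Hp.
Qed.

Lemma scont_AngMom (p : state) : valg (fun f => scont f p) AngMom.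
Proof.
  apply (valg_cross _ (scont_algebra p)); [apply scont_fst | apply scont_snd].
Qed.

Lemma scont_Energy (p : state) : in_domain p -> scont (Energy U) p.
Proof.
  intros Hp; pose proof (scont_snd p) as Hv.
  pose proof (scont_radial U U1 p HU Hp) as H.
  unfold Energy; valg_tac (scont_algebra p).
Qed.

Lemma scont_Vfun (k1 k2 E0 : R) (L0 : vec3) (p : state) :
  in_domain p -> scont (Vfun U k1 k2 E0 L0) p.
Proof.
  intros Hp; pose proof (scont_Energy p Hp) as HE; pose proof (scont_AngMom p) as HL.
  unfold Vfun; valg_tac (scont_algebra p).
Qed.

Lemma scont_circular_defect (p : state) :
  in_domain p -> scont (circular_defect U U1) p.
Proof.
  intros Hp; pose proof (scont_Energy p Hp) as HE; pose proof (scont_AngMom p) as HL.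
  pose proof (scont_radial U U1 p HU Hp); pose proof (scont_radial U1 U2 p HU1 Hp).
  pose proof (scont_vnorm p).
  unfold circular_defect; cbv zeta; valg_tac (scont_algebra p).
Qed.

Lemma scont_gradV_sqr (k1 k2 E0 : R) (L0 : vec3) (p : state) :
  in_domain p ->
  scont (fun q => sdot (gradV U U1 k1 k2 E0 L0 q) (gradV U U1 k1 k2 E0 L0 q)) p.
Proof.
  intros Hp; pose proof (scont_fst p) as Hx; pose proof (scont_snd p) as Hv.
  pose proof (scont_radial U U1 p HU Hp); pose proof (scont_radial U1 U2 p HU1 Hp).
  assert (scont (fun q => / vnorm (fst q)) p).
  { apply (scont_comp Rinv); [apply scont_vnorm|].
    pose proof (vnorm_pos _ Hp) as Hr.
    apply (continuity_pt_inv (fun x => x)); [apply continuity_pt_id | lra]. }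
  exact (grad_expr_algebra _ k1 k2 E0 L0 fst snd (fun q => U (vnorm (fst q)))
    (fun q => U1 (vnorm (fst q))) (fun q => / vnorm (fst q))
    (scont_algebra p) Hx Hv ltac:(assumption) ltac:(assumption) ltac:(assumption)).
Qed.

End Continuity.

(** * Bounded Lipschitz fields and their flow *)

(** The Lipschitz condition is for the maximum norm, phrased with a common bound [d] on coordinate
    differences to match the hypotheses of [picard_global]. *)
Definition bounded_lipschitz_with (B L : R) (f : state -> R) : Prop :=
  (forall p, Rabs (f p) <= B) /\
  forall p q d, (forall i, Rabs (coord i p - coord i q) <= d) ->
    Rabs (f p - f q) <= L * d.

Definition bounded_lipschitz (f : state -> R) : Prop :=
  exists B L, bounded_lipschitz_with B L f.

Lemma close_ge0 (p q : state) (d : R) :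
  (forall i, Rabs (coord i p - coord i q) <= d) -> 0 <= d.
Proof. intros H; eapply Rle_trans; [apply Rabs_pos | apply (H 0%nat)]. Qed.

(** Boundedness is kept alongside because the Lipschitz constant of a product involves bounds on its
    factors. *)
Lemma bounded_lipschitz_algebra : function_algebra bounded_lipschitz.
Proof.
  split.
  - intros a; exists (Rabs a), 0; split; intros; [lra|].
    unfold Rminus; rewrite Rplus_opp_r, Rabs_R0; lra.
  - intros f g (B & L & Hf & Lf) (C & M & Hg & Lg).
    exists (B + C), (L + M); split.
    + intros p; eapply Rle_trans; [apply Rabs_triang|].
      specialize (Hf p); specialize (Hg p); lra.
    + intros p q d Hd.
      replace (f p + g p - (f q + g q)) with ((f p - f q) + (g p - g q)) by ring.
      eapply Rle_trans; [apply Rabs_triang|].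
      specialize (Lf p q d Hd); specialize (Lg p q d Hd); lra.
  - intros f g (B & L & Hf & Lf) (C & M & Hg & Lg).
    exists (B * C), (C * L + B * M); split.
    + intros p; rewrite Rabs_mult; apply Rmult_le_compat; auto using Rabs_pos.
    + intros p q d Hd.
      replace (f p * g p - f q * g q) with ((f p - f q) * g p + f q * (g p - g q)) by ring.
      eapply Rle_trans; [apply Rabs_triang|]; rewrite !Rabs_mult.
      pose proof (Rmult_le_compat _ _ _ _ (Rabs_pos _) (Rabs_pos _) (Lf p q d Hd) (Hg p)).
      pose proof (Rmult_le_compat _ _ _ _ (Rabs_pos _) (Rabs_pos _) (Hf q) (Lg p q d Hd)).
      lra.
Qed.

Lemma bounded_lipschitz_scont (f : state -> R) (p : state) :
  bounded_lipschitz f -> scont f p.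
Proof.
  intros (B & L & _ & Lf); apply filterlim_locally; intros eps.
  pose proof (Rabs_pos L) as HL; pose proof (Rle_abs L); pose proof (cond_pos eps).
  assert (Hd : 0 < eps / (Rabs L + 1)) by (apply Rdiv_lt_0_compat; lra).
  exists (eps / (Rabs L + 1)); split; [exact Hd|]; intros q Hq.
  change (Rabs (f q - f p) < eps).
  rewrite Rabs_minus_sym.
  apply Rle_lt_trans with (L * sdist p q); [apply Lf; intros; apply coord_le_sdist|].
  assert (0 <= sdist p q) by (unfold sdist; apply sqrt_pos).
  apply Rmult_lt_compat_r with (r := Rabs L + 1) in Hq; [|lra].
  unfold Rdiv in Hq; rewrite Rmult_assoc, Rinv_l in Hq by lra.
  nra.
Qed.

Definition clamp (a b r : R) : R := Rmax a (Rmin r b).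

Lemma clamp_in (a b r : R) : a <= b -> a <= clamp a b r <= b.
Proof.
  intros H; unfold clamp, Rmax, Rmin.
  destruct (Rle_dec r b); destruct (Rle_dec a _); lra.
Qed.

Lemma clamp_id (a b r : R) : a <= r <= b -> clamp a b r = r.
Proof.
  intros H; unfold clamp, Rmax, Rmin.
  destruct (Rle_dec r b); destruct (Rle_dec a _); lra.
Qed.

Lemma clamp_lipschitz (a b r s : R) : Rabs (clamp a b r - clamp a b s) <= Rabs (r - s).
Proof.
  pose proof (Rle_abs (r - s)); pose proof (Rle_abs (s - r)) as H'.
  rewrite Rabs_minus_sym in H'; apply Rabs_le.
  unfold clamp, Rmax, Rmin.
  destruct (Rle_dec r b), (Rle_dec s b); repeat destruct (Rle_dec a _); lra.
Qed.

Lemma bounded_lipschitz_clamp_coord (M : R) (i : nat) :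
  0 <= M -> bounded_lipschitz (fun p => clamp (- M) M (coord i p)).
Proof.
  intros HM; exists M, 1; split.
  - intros p; apply Rabs_le_between, clamp_in; lra.
  - intros p q d Hd; eapply Rle_trans; [apply clamp_lipschitz|].
    specialize (Hd i); lra.
Qed.

Lemma C1_lipschitz_on (h h' : R -> R) (a b : R) :
  a <= b ->
  (forall r, a <= r <= b -> derivable_pt_lim h r (h' r)) ->
  (forall r, a <= r <= b -> continuity_pt h' r) ->
  exists C, 0 <= C /\ forall r s, a <= r <= b -> a <= s <= b ->
    Rabs (h r - h s) <= C * Rabs (r - s).
Proof.
  intros Hab Hh Hh'.
  destruct (continuity_ab_maj (fun r => Rabs (h' r)) a b Hab) as [m [Hm _]].
  { intros r Hr; apply (continuity_pt_comp h' Rabs);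
      [now apply Hh' | apply Rcontinuity_abs]. }
  exists (Rabs (h' m)); split; [apply Rabs_pos|].
  assert (W : forall r s, a <= r <= b -> a <= s <= b -> s < r ->
    Rabs (h r - h s) <= Rabs (h' m) * Rabs (r - s)).
  { intros r s Hr Hs Hrs.
    destruct (MVT_cor2 h h' s r Hrs) as [c [E Hc]].
    - intros c Hc; apply Hh; lra.
    - rewrite E, Rabs_mult; apply Rmult_le_compat_r; [apply Rabs_pos | apply Hm; lra]. }
  intros r s Hr Hs; destruct (Rtotal_order r s) as [H|[<-|H]].
  - rewrite Rabs_minus_sym, (Rabs_minus_sym r s); auto.
  - unfold Rminus; rewrite !Rplus_opp_r, Rabs_R0; lra.
  - auto.
Qed.

Lemma bounded_lipschitz_comp_clamp (h h' : R -> R) (a b : R) (f : state -> R) :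
  a <= b ->
  (forall r, a <= r <= b -> derivable_pt_lim h r (h' r)) ->
  (forall r, a <= r <= b -> continuity_pt h' r) ->
  bounded_lipschitz f -> bounded_lipschitz (fun p => h (clamp a b (f p))).
Proof.
  intros Hab Hh Hh' (B & L & _ & Lf).
  destruct (C1_lipschitz_on h h' a b Hab Hh Hh') as [C [HC Lh]].
  exists (Rabs (h a) + C * (b - a)), (C * L); split.
  - intros p; pose proof (clamp_in a b (f p) Hab) as Hc.
    specialize (Lh (clamp a b (f p)) a Hc ltac:(lra)).
    rewrite (Rabs_pos_eq (_ - a)) in Lh by lra.
    pose proof (Rabs_triang (h (clamp a b (f p)) - h a) (h a)) as T.
    replace (h (clamp a b (f p)) - h a + h a) with (h (clamp a b (f p))) in T by ring.
    nra.
  - intros p q d Hd.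
    eapply Rle_trans; [apply Lh; now apply clamp_in|].
    rewrite Rmult_assoc; apply Rmult_le_compat_l; [exact HC|].
    eapply Rle_trans; [apply clamp_lipschitz | now apply Lf].
Qed.

(** The clamp acts on the squared radius, which is polynomial in the coordinates. Above [a > 0] the
    square root is smooth, so [h] composed with [sqrt] is [C^1] on the clamped interval. *)
Lemma bounded_lipschitz_radial (h h' : R -> R) (a b : R) (f : state -> R) :
  0 < a -> a <= b ->
  (forall r, 0 < r -> derivable_pt_lim h r (h' r)) ->
  (forall r, 0 < r -> continuity_pt h' r) ->
  bounded_lipschitz f -> bounded_lipschitz (fun p => h (sqrt (clamp a b (f p)))).
Proof.
  intros Ha Hab Hh Hh' Hf.
  apply (bounded_lipschitz_comp_clamp (fun s => h (sqrt s))
    (fun s => h' (sqrt s) * / (2 * sqrt s)) a b f Hab); [| |exact Hf].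
  - intros s Hs.
    apply (derivable_pt_lim_comp sqrt h s (/ (2 * sqrt s)) (h' (sqrt s))).
    + apply derivable_pt_lim_sqrt; lra.
    + apply Hh, sqrt_lt_R0; lra.
  - intros s Hs.
    assert (Hq : 0 < sqrt s) by (apply sqrt_lt_R0; lra).
    assert (Cq : continuity_pt sqrt s) by (apply continuity_pt_sqrt; lra).
    apply (continuity_pt_mult (fun s => h' (sqrt s)) (fun s => / (2 * sqrt s))).
    + apply (continuity_pt_comp sqrt h'); [exact Cq | now apply Hh'].
    + apply (continuity_pt_inv (fun s => 2 * sqrt s)); [|lra].
      apply (continuity_pt_mult (fun _ => 2) sqrt); [|exact Cq].
      apply continuity_pt_const; intros ? ?; reflexivity.
Qed.

Lemma bounded_lipschitz_with_mono (B B' L L' : R) (f : state -> R) :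
  B <= B' -> L <= L' -> bounded_lipschitz_with B L f -> bounded_lipschitz_with B' L' f.
Proof.
  intros HB HL [Hf Lf]; split.
  - intros p; eapply Rle_trans; [apply Hf | exact HB].
  - intros p q d Hd; eapply Rle_trans; [now apply Lf|].
    apply Rmult_le_compat_r; [eapply close_ge0; eauto | exact HL].
Qed.

Lemma bounded_lipschitz_uniform (F : state -> state) :
  (forall i, bounded_lipschitz (fun p => coord i (F p))) ->
  exists B L, 1 <= L /\ forall i, bounded_lipschitz_with B L (fun p => coord i (F p)).
Proof.
  intros HF.
  destruct (HF 0%nat) as (B0 & L0 & H0), (HF 1%nat) as (B1 & L1 & H1),
    (HF 2%nat) as (B2 & L2 & H2), (HF 3%nat) as (B3 & L3 & H3),
    (HF 4%nat) as (B4 & L4 & H4), (HF 5%nat) as (B5 & L5 & H5).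
  set (B := Rmax B0 (Rmax B1 (Rmax B2 (Rmax B3 (Rmax B4 B5))))).
  set (L := Rmax 1 (Rmax L0 (Rmax L1 (Rmax L2 (Rmax L3 (Rmax L4 L5)))))).
  assert (R1 : forall x y z, x <= y -> x <= Rmax y z)
    by (intros; eapply Rle_trans; [eassumption | apply Rmax_l]).
  assert (R2 : forall x y z, x <= z -> x <= Rmax y z)
    by (intros; eapply Rle_trans; [eassumption | apply Rmax_r]).
  exists B, L; split; [apply Rmax_l|].
  intros [|[|[|[|[|i]]]]];
    (eapply bounded_lipschitz_with_mono;
      [ | | first [exact H0 | exact H1 | exact H2 | exact H3 | exact H4 | exact H5]]);
    unfold B, L; auto 10 using Rle_refl.
Qed.

Lemma bounded_lipschitz_flow (F : state -> state) (p : state) :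
  (forall i, bounded_lipschitz (fun q => coord i (F q))) ->
  exists g, g 0 = p /\ forall t, 0 <= t -> has_sderiv g t (F (g t)).
Proof.
  intros HF; destruct (bounded_lipschitz_uniform F HF) as (B & L & HL & H).
  destruct (picard_global nat (fun i y => coord i (F (of_coords y)))
    (fun i => coord i p) B L) as [y [Hy0 Hy]].
  - exact HL.
  - intros i y; apply (H i).
  - intros i y z d Hd; apply (proj2 (H i)), of_coords_close, Hd.
  - intros i y t Hc.
    apply (scont_curve (fun q => coord i (F q)) (fun s => of_coords (fun j => y j s))).
    + intros [|[|[|[|[|k]]]]]; apply Hc.
    + now apply bounded_lipschitz_scont.
  - exists (fun t => of_coords (fun i => y i t)); split.
    + rewrite <- (of_coordsK p); unfold of_coords; now rewrite !Hy0.
    + intros t Ht.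
      assert (D : forall i, derivable_pt_lim (y i) t
        (coord i (F (of_coords (fun j => y j t))))).
      { intros i; apply is_derive_Reals; specialize (Hy i t).
        now rewrite Rmax_left in Hy by lra. }
      repeat split; [apply (D 0%nat) | apply (D 1%nat) | apply (D 2%nat)
        | apply (D 3%nat) | apply (D 4%nat) | apply (D 5%nat)].
Qed.

(* On the region the field is the restriction of one obtained by clamping the
   coordinates and [|x|^2] to compact intervals. *)
Lemma controlled_field_extension (U U1 U2 : R -> R) (k1 k2 E0 M m : R) (L0 : vec3) :
  (forall r, 0 < r -> derivable_pt_lim U r (U1 r)) ->
  (forall r, 0 < r -> derivable_pt_lim U1 r (U2 r)) ->
  (forall r, 0 < r -> continuity_pt U2 r) ->
  0 < m ->
  exists F : state -> state,
    (forall i, bounded_lipschitz (fun q => coord i (F q))) /\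
    forall q, (forall i, Rabs (coord i q) <= M) -> m <= vdot (fst q) (fst q) ->
      F q = controlled_field U U1 k1 k2 E0 L0 q.
Proof.
  intros HU HU1 HU2 Hm.
  (* Coordinates bounded by [N] give [|x|^2 <= 3 * (N * N)], so the upper clamp is inactive on the
     region; the summand [m] ensures [m <= b]. *)
  set (N := Rabs M); set (b := m + 3 * (N * N)).
  assert (HN : 0 <= N) by apply Rabs_pos.
  assert (Hb : m <= b) by (unfold b; nra).
  set (cl := clamp (- N) N).
  set (x := fun q => mkv (cl (coord 0 q)) (cl (coord 1 q)) (cl (coord 2 q))).
  set (v := fun q => mkv (cl (coord 3 q)) (cl (coord 4 q)) (cl (coord 5 q))).
  set (r := fun q => sqrt (clamp m b (vdot (x q) (x q)))).
  pose proof (fun i => bounded_lipschitz_clamp_coord N i HN) as Hcl.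
  assert (Hx : valg bounded_lipschitz x)
    by exact (conj (Hcl 0%nat) (conj (Hcl 1%nat) (Hcl 2%nat))).
  assert (Hv : valg bounded_lipschitz v)
    by exact (conj (Hcl 3%nat) (conj (Hcl 4%nat) (Hcl 5%nat))).
  assert (Hxx : bounded_lipschitz (fun q => vdot (x q) (x q)))
    by now apply (valg_dot _ bounded_lipschitz_algebra).
  exists (fun q => field_expr k1 k2 E0 L0 (x q) (v q) (U (r q)) (U1 (r q)) (/ r q)).
  split.
  - apply field_expr_algebra; auto using bounded_lipschitz_algebra.
    + apply (bounded_lipschitz_radial U U1 m b); auto.
      intros s Hs; apply (derivable_continuity U1 U2); auto.
    + apply (bounded_lipschitz_radial U1 U2 m b); auto.
    + apply (bounded_lipschitz_radial Rinv (fun s => - / (s * s)) m b); auto.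
      * intros s Hs; apply is_derive_Reals; auto_derive; [lra|].
        field; lra.
      * intros s Hs; apply continuity_pt_opp.
        apply (continuity_pt_inv (fun s => s * s)); [|nra].
        apply (continuity_pt_mult (fun s => s) (fun s => s)); apply continuity_pt_id.
  - intros q Hq Hqm.
    assert (Hc : forall i, cl (coord i q) = coord i q).
    { intros i; apply clamp_id, Rabs_le_between.
      eapply Rle_trans; [apply Hq | apply Rle_abs]. }
    assert (Ex : x q = fst q)
      by (unfold x; rewrite !Hc; destruct q as [[? ? ?] ?]; reflexivity).
    assert (Ev : v q = snd q)
      by (unfold v; rewrite !Hc; destruct q as [? [? ? ?]]; reflexivity).
    assert (Er : r q = vnorm (fst q)).
    { unfold r; rewrite Ex, clamp_id; [reflexivity|].
      split; [exact Hqm|].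
      assert (S : forall i, coord i q * coord i q <= N * N).
      { intros i; apply Rsqr_le_abs_1; unfold N; rewrite Rabs_Rabsolu.
        eapply Rle_trans; [apply Hq | apply Rle_abs]. }
      pose proof (S 0%nat); pose proof (S 1%nat); pose proof (S 2%nat).
      unfold b, vdot; simpl in *; lra. }
    rewrite Ex, Ev, Er; reflexivity.
Qed.

(** * Decay of [Vfun] along trajectories *)

Lemma has_sderiv_cont_curve (g : R -> state) (t : R) (d : state) :
  has_sderiv g t d -> cont_curve g t.
Proof.
  assert (C : forall (f : R -> R) l, derivable_pt_lim f t l -> continuous f t).
  { intros f l Hf; apply continuity_pt_filterlim.
    apply derivable_continuous_pt; exists l; exact Hf. }
  intros (H1 & H2 & H3 & H4 & H5 & H6) [|[|[|[|[|i]]]]]; simpl; eapply C; eassumption.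
Qed.

(** Let [T] be the supremum of the times up to which [phi] is negative. Continuity gives
    [phi T <= 0], the step hypothesis makes it strict, and continuity then carries negativity beyond
    [T], a contradiction. *)
Lemma real_induction_neg (phi : R -> R) :
  (forall t, 0 <= t -> continuous phi t) -> phi 0 < 0 ->
  (forall T, 0 <= T -> (forall t, 0 <= t <= T -> phi t <= 0) -> phi T < 0) ->
  forall t, 0 <= t -> phi t < 0.
Proof.
  intros Hc H0 Hstep t1 Ht1; apply Rnot_le_lt; intros Hge.
  set (S := fun t => 0 <= t /\ forall s, 0 <= s <= t -> phi s < 0).
  destruct (completeness S) as [T [Hub Hlub]].
  - exists t1; intros t [Ht HS]; apply Rnot_lt_le; intros Hlt.
    specialize (HS t1 ltac:(lra)); lra.
  - exists 0; split; [lra|]; intros s Hs; now replace s with 0 by lra.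
  - assert (HT0 : 0 <= T).
    { apply Hub; split; [lra|]; intros s Hs; now replace s with 0 by lra. }
    assert (Hbelow : forall t, 0 <= t < T -> phi t < 0).
    { intros t Ht; apply NNPP; intros Hn.
      assert (T <= t); [|lra].
      apply Hlub; intros u [Hu HS]; apply Rnot_lt_le; intros Htu.
      apply Hn, HS; lra. }
    assert (HTle : phi T <= 0).
    { apply Rnot_lt_le; intros HTpos.
      destruct (Hc T HT0 (fun y => 0 < y) (open_gt 0 (phi T) HTpos)) as [e He].
      pose proof (cond_pos e).
      destruct (Req_dec T 0) as [->|HTn]; [lra|].
      set (u := Rmax 0 (T - e / 2)).
      assert (Hu : 0 <= u < T /\ T - e / 2 <= u)
        by (unfold u, Rmax; destruct (Rle_dec 0 (T - e / 2)); lra).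
      specialize (Hbelow u ltac:(lra)).
      assert (0 < phi u); [|lra].
      apply He; change (Rabs (u - T) < e); apply Rabs_def1; lra. }
    assert (HTneg : phi T < 0).
    { apply Hstep; [exact HT0|]; intros t Ht.
      destruct (Req_dec t T) as [->|]; [exact HTle | apply Rlt_le, Hbelow; lra]. }
    destruct (Hc T HT0 (fun y => y < 0) (open_lt 0 (phi T) HTneg)) as [e He].
    pose proof (cond_pos e).
    assert (T + e / 2 <= T); [|lra].
    apply Hub; split; [lra|]; intros s Hs.
    destruct (Rlt_le_dec s T); [apply Hbelow; lra|].
    apply He; change (Rabs (s - T) < e); apply Rabs_def1; lra.
Qed.

Section Trajectories.

Variables (U U1 : R -> R) (k1 k2 E0 : R) (L0 : vec3).
Hypothesis HU : forall r, 0 < r -> derivable_pt_lim U r (U1 r).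

Let V := Vfun U k1 k2 E0 L0.
Let F := controlled_field U U1 k1 k2 E0 L0.
Let G := gradV U U1 k1 k2 E0 L0.

Lemma sdot_self_ge0 (p : state) : 0 <= sdot p p.
Proof. apply Rplus_le_le_0_compat; apply vdot_self_ge0. Qed.

(** The mean value theorem for a function with derivative [- sdot G G]. Taking [m = 0] gives
    monotonicity, and a positive [m] a linear rate. *)
Lemma Vfun_decay (g : R -> state) (m a b : R) :
  a <= b ->
  (forall t, a <= t <= b ->
     in_domain (g t) /\ has_sderiv g t (F (g t)) /\ m <= sdot (G (g t)) (G (g t))) ->
  V (g b) <= V (g a) - m * (b - a).
Proof.
  intros Hab Hg; destruct (Req_dec a b) as [<-|Hne]; [lra|].
  destruct (MVT_cor2 (fun s => V (g s)) (fun t => - sdot (G (g t)) (G (g t))) a b)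
    as [c [E Hc]].
  - lra.
  - intros c Hc; destruct (Hg c Hc) as (Hdom & Hder & _).
    unfold G; rewrite <- (gradV_dot_field U U1 k1 k2 E0 L0 (g c)).
    now apply Vfun_chain.
  - destruct (Hg c ltac:(lra)) as (_ & _ & Hm); nra.
Qed.

(** While [psi <= 0], [V] does not increase and stays at most [c], so [psi = 0] is never reached.
    The differential equation is assumed only where [psi <= 0], so that the flow of an extended
    field qualifies. *)
Lemma sublevel_trapping (psi : state -> R) (c : R) (g : R -> state) :
  (forall p, scont psi p) -> (forall p, psi p <= 0 -> in_domain p) ->
  (forall p, psi p = 0 -> c < V p) ->
  (forall t, 0 <= t -> cont_curve g t) ->
  (forall t, 0 <= t -> psi (g t) <= 0 -> has_sderiv g t (F (g t))) ->
  psi (g 0) < 0 -> V (g 0) <= c ->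
  forall t, 0 <= t -> psi (g t) < 0 /\ V (g t) <= c.
Proof.
  intros Hpsi Hdom Hbd Hcont Hder H0 HV0.
  assert (HV : forall T, 0 <= T -> (forall t, 0 <= t <= T -> psi (g t) <= 0) ->
    V (g T) <= c).
  { intros T HT Hle.
    apply Rle_trans with (V (g 0) - 0 * (T - 0)); [|lra].
    apply Vfun_decay; [exact HT|]; intros t Ht.
    split; [apply Hdom, Hle, Ht|]; split; [apply Hder; [lra | apply Hle, Ht]|].
    apply sdot_self_ge0. }
  assert (Hneg : forall t, 0 <= t -> psi (g t) < 0).
  { apply (real_induction_neg (fun t => psi (g t))); [|exact H0|].
    - intros t Ht; apply scont_curve; auto.
    - intros T HT Hle; destruct (Hle T ltac:(lra)) as [|E]; [assumption|].
      specialize (HV T HT Hle); specialize (Hbd _ E); lra. }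
  intros t Ht; split; [now apply Hneg|].
  apply HV; [exact Ht|]; intros s Hs; apply Rlt_le, Hneg; lra.
Qed.

End Trajectories.

(** * The zero set of [Vfun] and its asymptotic stability *)

Lemma Vfun_ge0 (U : R -> R) (k1 k2 E0 : R) (L0 : vec3) (p : state) :
  0 < k1 -> 0 < k2 -> 0 <= Vfun U k1 k2 E0 L0 p.
Proof.
  intros Hk1 Hk2; unfold Vfun.
  apply Rplus_le_le_0_compat; apply Rmult_le_pos; try lra.
  - apply pow2_ge_0.
  - apply vdot_self_ge0.
Qed.

Lemma Vfun_eq0 (U : R -> R) (k1 k2 E0 : R) (L0 : vec3) (p : state) :
  0 < k1 -> 0 < k2 ->
  Vfun U k1 k2 E0 L0 p = 0 <-> Energy U p = E0 /\ AngMom p = L0.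
Proof.
  intros Hk1 Hk2; unfold Vfun; split.
  - intros H; pose proof (pow2_ge_0 (Energy U p - E0)).
    pose proof (vdot_self_ge0 (vsub (AngMom p) L0)).
    assert (A : (Energy U p - E0) ^ 2 = 0) by nra.
    assert (B : vdot (vsub (AngMom p) L0) (vsub (AngMom p) L0) = 0) by nra.
    split; [nra | now apply vsub_eq0, vdot_self_eq0].
  - intros [-> ->]; rewrite vsub_diag, vzero_dot; ring.
Qed.

Theorem theorem7 (U U1 U2 : R -> R) (k1 k2 : R) (x0 v0 : vec3)
  (HU : forall r, 0 < r -> derivable_pt_lim U r (U1 r))
  (HU1 : forall r, 0 < r -> derivable_pt_lim U1 r (U2 r))
  (HU2 : forall r, 0 < r -> continuity_pt U2 r)
  (Hx0 : x0 <> vzero)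
  (HL0 : vcross x0 v0 <> vzero)
  (Hk1 : 0 < k1) (Hk2 : 0 < k2) :
  let E0 := Energy U (x0, v0) in
  let L0 := AngMom (x0, v0) in
  let V := Vfun U k1 k2 E0 L0 in
  let Z := fun p => in_domain p /\ V p = 0 in
  scompact Z ->
  ~ (exists r, 0 < r /\ E0 = / 2 * r * U1 r + U r /\
                 vdot L0 L0 = r ^ 3 * U1 r) ->
  exists (W : state -> Prop) (c : R),
    sopen W /\ (forall p, W p -> in_domain p) /\ (forall p, Z p -> W p) /\
    0 < c /\
    let K := fun p => W p /\ V p <= c in
    scompact K /\
    (forall p, K p -> critical_point V p -> V p = 0) /\
    (forall p, K p -> exists g, g 0 = p /\
        forward_solution (controlled_field U U1 k1 k2 E0 L0) g) /\
    (forall g, K (g 0) ->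
        forward_solution (controlled_field U U1 k1 k2 E0 L0) g ->
        (forall t, 0 <= t -> K (g t)) /\ converges_to_set g Z) /\
    (forall p, Z p <-> (in_domain p /\ Energy U p = E0 /\ AngMom p = L0)).
Proof.
  intros E0 L0 V Z HZ Hcirc.
  set (G := gradV U U1 k1 k2 E0 L0).
  assert (HZE : forall p, Z p <-> (in_domain p /\ Energy U p = E0 /\ AngMom p = L0)).
  { intros p; unfold Z; split; intros [H1 H2]; (split; [exact H1|]);
      apply (Vfun_eq0 U k1 k2 E0 L0 p Hk1 Hk2); exact H2. }
  assert (Vge0 : forall p, 0 <= V p) by (intros; now apply Vfun_ge0).
  assert (Vcont : forall p, in_domain p -> scont V p)
    by (intros; now apply (scont_Vfun U U1 HU)).
  (* The conditions required by [gradV_eq0], written as strict inequalities so that they persist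
     near each point of [Z]. *)
  set (W0 := fun p => 0 < vdot (fst p) (fst p) /\ 0 < vdot (AngMom p) (AngMom p) /\
    0 < circular_defect U U1 p).
  assert (W0dom : forall p, W0 p -> in_domain p).
  { intros p [H _] E; rewrite E, vzero_dot in H; lra. }
  assert (W0crit : forall p, W0 p -> sdot (G p) (G p) = 0 -> V p = 0).
  { intros p Hp HG; apply (gradV_eq0 U U1); auto; apply Hp. }
  assert (HZW0 : forall p, Z p -> snbhd p W0).
  { intros p Hp; destruct (proj1 (HZE p) Hp) as (Hd & HE & HL).
    apply filter_and; [|apply filter_and].
    - apply scont_gt; [|now apply vdot_self_pos].
      apply (valg_dot _ (scont_algebra p)); apply scont_fst.
    - apply scont_gt; [|rewrite HL; now apply vdot_self_pos].
      apply (valg_dot _ (scont_algebra p)); apply scont_AngMom.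
    - apply scont_gt; [now apply (scont_circular_defect U U1 U2)|].
      unfold circular_defect; cbv zeta; rewrite HE, HL.
      set (r := vnorm (fst p)).
      assert (Hr : 0 < r) by now apply vnorm_pos.
      (* On [Z] the energy is [E0] and the angular momentum is [L0], so a vanishing defect would
         make [r] a radius excluded by [Hcirc]. *)
      apply Rnot_le_lt; intros Hle; apply Hcirc; exists r.
      pose proof (pow2_ge_0 (E0 - (/ 2 * r * U1 r + U r))).
      pose proof (pow2_ge_0 (vdot L0 L0 - r ^ 3 * U1 r)).
      assert (A : (E0 - (/ 2 * r * U1 r + U r)) ^ 2 = 0) by lra.
      assert (B : (vdot L0 L0 - r ^ 3 * U1 r) ^ 2 = 0) by lra.
      rewrite <- Rsqr_pow2 in A, B; apply Rsqr_0_uniq in A, B.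
      split; [exact Hr | split; lra]. }
  destruct (compact_separating_function Z W0 HZ HZW0)
    as (psi & Hpsi & HpsiW & Hbdd & HZpsi).
  assert (Hpsidom : forall p, psi p <= 0 -> in_domain p) by auto.
  assert (Hclosed : sclosed (fun p => psi p <= 0))
    by (intros p Hp; now apply snbhd_not_le).
  assert (Hcpt : forall B : state -> Prop,
    (forall p, psi p <= 0 -> ~ B p -> snbhd p (fun q => ~ B q)) ->
    scompact (fun p => psi p <= 0 /\ B p)).
  { intros B HB; apply heine_borel; [|now apply sclosed_and].
    eapply sbounded_mono; [|exact Hbdd]; intros p [Hp _]; exact Hp. }
  (* The shell [psi = 0] is compact and misses [Z], where [psi < 0]; hence [V] has a positive lower
     bound [m] on it, and half of [m] is strictly below [V] there. *)
  destruct (compact_pos_min (fun p => psi p <= 0 /\ 0 <= psi p) V) as (m & Hm & HmV).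
  { apply Hcpt; intros p _ Hp; now apply snbhd_not_ge. }
  { intros p [Hp _]; auto. }
  { intros p [Hp Hp']; destruct (Vge0 p) as [H|H]; [exact H|].
    assert (psi p < 0); [|lra].
    apply HZpsi; split; auto. }
  set (c := m / 2).
  assert (Hbdc : forall p, psi p = 0 -> c < V p).
  { intros p Hp; specialize (HmV p ltac:(lra)); unfold c; lra. }
  set (K := fun p => psi p < 0 /\ V p <= c).
  (* Since [V <= c] rules out [psi = 0], the open condition [psi < 0] in [K] may be relaxed to the
     closed one, which is why [K] is compact. *)
  assert (HK : forall p, psi p <= 0 -> V p <= c -> K p).
  { intros p [Hp|Hp] HV; [now split|]; specialize (Hbdc p Hp); lra. }
  assert (HKcpt : forall B : state -> Prop,
    (forall p, psi p <= 0 -> ~ B p -> snbhd p (fun q => ~ B q)) ->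
    scompact (fun p => K p /\ B p)).
  { intros B HB I O HO Hcov.
    destruct (Hcpt (fun p => V p <= c /\ B p)) with (I := I) (O := O) as [l Hl].
    - intros p Hp HVB; destruct (classic (V p <= c)) as [HV|HV].
      + generalize (HB p Hp (fun b => HVB (conj HV b))); apply filter_imp; tauto.
      + generalize (snbhd_not_le V c p (Vcont p (Hpsidom p Hp)) HV).
        apply filter_imp; tauto.
    - exact HO.
    - intros p (Hp & HV & HBp); apply Hcov; split; [now apply HK | exact HBp].
    - exists l; intros p [[Hp HV] HBp]; apply Hl.
      split; [lra | now split]. }
  assert (Htrap := sublevel_trapping U U1 k1 k2 E0 L0 HU psi c).
  exists (fun p => psi p < 0), c.
  split; [intros p Hp; now apply scont_lt|].
  split; [intros p Hp; apply Hpsidom; lra|].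
  split; [exact HZpsi|].
  split; [unfold c; lra|].
  cbv zeta; fold K.
  split; [|split; [|split; [|split; [|exact HZE]]]].
  - intros I O HO Hcov; destruct (HKcpt (fun _ => True)) with (I := I) (O := O) as [l Hl].
    + intros p _ []; exact Logic.I.
    + exact HO.
    + intros p [Hp _]; auto.
    + exists l; intros p Hp; apply Hl; split; [exact Hp | exact Logic.I].
  - intros p [Hp HV] Hcrit.
    assert (Hp' : psi p <= 0) by lra.
    apply W0crit; [auto|].
    apply (critical_gradV U U1 k1 k2 E0 L0 p HU); auto.
  - intros p [Hp HV].
    (* The bound [a] keeps the region away from the singularity [x = 0], as the extension of the
       field requires. *)
    destruct (compact_pos_min (fun p => psi p <= 0 /\ True)
      (fun p => vdot (fst p) (fst p))) as (a & Ha & Hamin).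
    { apply Hcpt; intros q _ []; exact Logic.I. }
    { intros q _; apply (valg_dot _ (scont_algebra q)); apply scont_fst. }
    { intros q [Hq _]; apply vdot_self_pos, Hpsidom, Hq. }
    destruct Hbdd as [M HM].
    destruct (controlled_field_extension U U1 U2 k1 k2 E0 M a L0 HU HU1 HU2 Ha)
      as (F & HF & HFeq).
    assert (Feq : forall q, psi q <= 0 -> F q = controlled_field U U1 k1 k2 E0 L0 q)
      by (intros q Hq; apply HFeq; auto).
    destruct (bounded_lipschitz_flow F p HF) as (g & Hg0 & Hg).
    exists g; split; [exact Hg0|].
    (* Trapping confines the flow of [F] to the region where [F] is the controlled field, so this
       flow solves the original system. *)
    assert (Hin : forall t, 0 <= t -> psi (g t) < 0 /\ V (g t) <= c).
    { apply Htrap; auto.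
      - intros t Ht; eapply has_sderiv_cont_curve; eauto.
      - intros t Ht Hp'; rewrite <- Feq by exact Hp'; auto.
      - now rewrite Hg0.
      - now rewrite Hg0. }
    intros t Ht; destruct (Hin t Ht) as [Hp' _].
    split; [apply Hpsidom; lra|].
    rewrite <- Feq by lra; auto.
  - intros g [Hp0 HV0] Hg.
    assert (Hin : forall t, 0 <= t -> K (g t)).
    { apply Htrap; auto.
      - intros t Ht; eapply has_sderiv_cont_curve; apply Hg, Ht.
      - intros t Ht _; apply Hg, Ht. }
    split; [exact Hin|].
    assert (Hdecay : forall a b n, 0 <= a <= b ->
      (forall t, a <= t <= b -> n <= sdot (G (g t)) (G (g t))) ->
      V (g b) <= V (g a) - n * (b - a)).
    { intros a b n Hab Hn; apply (Vfun_decay U U1 k1 k2 E0 L0 HU g n a b); [lra|].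
      intros t Ht; destruct (Hg t ltac:(lra)) as [H1 H2]; auto. }
    assert (Hto0 : forall eps, 0 < eps -> exists T, 0 <= T /\ V (g T) < eps).
    { intros eps Heps; apply NNPP; intros Hno.
      assert (Hge : forall t, 0 <= t -> eps <= V (g t)).
      { intros t Ht; apply Rnot_lt_le; intros Hlt; apply Hno; exists t; auto. }
      destruct (compact_pos_min (fun p => K p /\ eps <= V p)
        (fun p => sdot (G p) (G p))) as (n & Hn & Hmin).
      { apply HKcpt; intros p Hp Hp'; apply snbhd_not_ge; auto. }
      { intros p [[Hp _] _]; apply (scont_gradV_sqr U U1 U2); auto.
        apply Hpsidom; lra. }
      { intros p [[Hp _] HVp]; destruct (sdot_self_ge0 (G p)) as [H|H]; [exact H|].
        assert (V p = 0); [|lra].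
        apply W0crit; [apply HpsiW; lra | auto]. }
      (* Decay at rate [n] up to this time would force [V (g T) <= -1]. *)
      set (T := (V (g 0) + 1) / n).
      assert (HT : 0 <= T).
      { apply Rlt_le, Rdiv_lt_0_compat; [specialize (Vge0 (g 0)); lra | exact Hn]. }
      assert (H : V (g T) <= V (g 0) - n * (T - 0)).
      { apply Hdecay; [lra|]; intros t Ht; apply Hmin.
        split; [apply Hin | apply Hge]; lra. }
      replace (n * (T - 0)) with (V (g 0) + 1) in H by (unfold T; field; lra).
      specialize (Vge0 (g T)); lra. }
    intros eps Heps.
    (* The points of [K] at distance at least [eps] from [Z] form a compact set on which [V] is at
       least some [n > 0]; once [V] falls below [n], monotonicity keeps the trajectory within [eps]
       of [Z]. *)
    destruct (compact_pos_min (fun p => K p /\ forall q, Z q -> eps ^ 2 <= sqdist p q) V)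
      as (n & Hn & Hmin).
    (* A point close to [Z] has a single witness [q], and the same [q] serves all nearby points. *)
    { apply HKcpt; intros p Hp Hno.
      apply not_all_ex_not in Hno; destruct Hno as [q Hq].
      apply imply_to_and in Hq; destruct Hq as [Zq Hq].
      generalize (snbhd_not_ge (fun p => sqdist p q) (eps ^ 2) p (scont_sqdist q p) Hq).
      apply filter_imp; intros p' Hp' Hall; apply Hp', Hall, Zq. }
    { intros p [[Hp _] _]; apply Vcont, Hpsidom; lra. }
    { intros p [[Hp _] Hfar]; destruct (Vge0 p) as [H|H]; [exact H|].
      assert (HZp : Z p) by (split; [apply Hpsidom; lra | auto]).
      specialize (Hfar p HZp); rewrite sqdist_refl in Hfar; nra. }
    destruct (Hto0 n Hn) as (T & HT & HVT).
    exists T; intros t Ht; apply NNPP; intros Hno.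
    assert (Hfar : n <= V (g t)).
    { apply Hmin; split; [apply Hin; lra|]; intros q Zq.
      apply Rnot_lt_le; intros Hlt; apply Hno; exists q; split; [exact Zq|].
      now apply sdist_lt. }
    assert (V (g t) <= V (g T) - 0 * (t - T)); [|lra].
    apply Hdecay; [lra|]; intros s _; apply sdot_self_ge0.
Qed.
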